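(* Let $\Omega$ be a Lempert domain (in $\mathbb{C}^n$ for some $n\ge 1$). Then $\Omega$ is biholomorphic to the bidisc $\mathbb{D}^2$ if and only if there is a minimal universal set for the Carathéodory extremal problem on $\Omega$ consisting of (exactly) two functions.
   Context: $\mathbb{D}$ is the open unit disc in $\mathbb{C}$. A domain is a connected (nonempty) open set in $\mathbb{C}^n$ for some integer $n\ge 1$. Datums. A datum $\delta$ in an open set $U\subseteq\mathbb{C}^n$ is either discrete, $\delta=(s_1,s_2)$ with $s_1,s_2\in U$, or infinitesimal, $\delta=(s,v)$ with $s\in U$, $v\in\mathbb{C}^n$. It is degenerate if $s_1=s_2$ (discrete case) or $v=0$ (infinitesimal case), and nondegenerate otherwise. If $F:U\to\Omega$ is holomorphic, then $F(\delta)=(F(s_1),F(s_2))$ for discrete $\delta$ and $F(\delta)=(F(s),D_vF(s))$ for infinitesimal $\delta$, where $D_vF(s)=\lim_{z\to0}(F(s+zv)-F(s))/z$; $F(\delta)$ is a datum in $\Omega$ of the same type as $\delta$. For a datum in $\mathbb{D}$: $|(z_1,z_2)|=\tanh^{-1}\left|\frac{z_1-z_2}{1-\overline{z_2}z_1}\right|$ (discrete), $|(z,v)|=\frac{|v|}{1-|z|^2}$ (infinitesimal). Extremal problems. For a domain $U$ and a nondegenerate datum $\delta$ in $U$, $|\delta|_{\rm car}=\sup\{|F(\delta)|: F:U\to\mathbb{D}\text{ holomorphic}\}$, and $|\delta|_{\rm kob}=\inf |\zeta|$, the infimum being over all datums $\zeta$ in $\mathbb{D}$ for which there is a holomorphic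 $f:\mathbb{D}\to U$ with $f(\zeta)=\delta$. A holomorphic $C:U\to\mathbb{D}$ solves $\mathrm{Car}\,\delta$ if $|C(\delta)|=|\delta|_{\rm car}$. Universal set. A set $\mathcal{C}$ of holomorphic maps $U\to\mathbb{D}$ is a universal set for the Carathéodory extremal problem on $U$ if for every nondegenerate datum $\delta$ in $U$ (discrete or infinitesimal) some $C\in\mathcal{C}$ solves $\mathrm{Car}\,\delta$. It is a minimal universal set if, in addition, no proper subset of $\mathcal{C}$ is a universal set for the Carathéodory extremal problem on $U$. Lempert domain. A domain $U$ in $\mathbb{C}^n$ is a Lempert domain if (1) $U$ is weakly hyperbolic, i.e. $|\delta|_{\rm car}>0$ for every nondegenerate datum $\delta$ in $U$; (2) $U$ is taut, i.e. the set of holomorphic maps $\mathbb{D}\to U$ is a normal family (every sequence has a subsequence that either converges locally uniformly to a holomorphic map $\mathbb{D}\to U$ or diverges compactly); and (3) $|\delta|_{\rm car}=|\delta|_{\rm kob}$ for every nondegenerate datum $\delta$ in $U$. *)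

(* Defs.v *)
From HB Require Import structures.
From mathcomp Require Export all_boot all_order all_algebra complex.
From mathcomp Require Export all_classical all_reals all_analysis.
Export numFieldNormedType.Exports.

Set Implicit Arguments.
Unset Strict Implicit.
Unset Printing Implicit Defensive.

Import Order.TTheory GRing.Theory Num.Theory.

Local Open Scope classical_set_scope.
Local Open Scope ring_scope.

(* The complex numbers are R[i] for R : realType. As a normed space, the complex
   line is R[i]^o : the library's normed space structure of a
   numFieldType over itself is attached to that alias. C^n is 'rV[R[i]]_n,
   whose library norm is the sup norm. *)

Section ComplexAnalysis.
Variable R : realType.
Implicit Types V W : normedModType R[i].

Definition disc : set R[i]^o := [set z | `|z| < 1].

Definition bidisc : set 'rV[R[i]]_2 := [set z | forall i, disc (z ord0 i)].

Definition domain V (U : set V) : Prop :=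
  [/\ open U, connected U & U !=set0].

(* Maps are total functions of which only the values on U matter.
   [differentiable] is Frechet differentiability over the scalar field R[i],
   that is, complex differentiability. It is only used for open U. *)
Definition holo V W (U : set V) (U' : set W) (F : V -> W) : Prop :=
  (forall z, U z -> differentiable F z) /\ (forall z, U z -> U' (F z)).

Definition biholomorphic V W (U : set V) (U' : set W) : Prop :=
  exists (F : V -> W) (G : W -> V),
    [/\ holo U U' F, holo U' U G,
        forall z, U z -> G (F z) = z & forall w, U' w -> F (G w) = w].

End ComplexAnalysis.

Variant datum (T : Type) : Type :=
  | Discrete (s1 s2 : T)
  | Infinitesimal (s v : T).

Section Datums.
Variable R : realType.
Implicit Types V W : normedModType R[i].

Definition datum_in V (U : set V) (d : datum V) : Prop :=
  match d with
  | Discrete s1 s2 => U s1 /\ U s2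
  | Infinitesimal s _ => U s
  end.

Definition nondegenerate V (d : datum V) : Prop :=
  match d with
  | Discrete s1 s2 => s1 <> s2
  | Infinitesimal _ v => v <> 0
  end.

Definition push V W (F : V -> W) (d : datum V) : datum W :=
  match d with
  | Discrete s1 s2 => Discrete (F s1) (F s2)
  | Infinitesimal s v => Infinitesimal (F s) ('D_v F s)
  end.

(* The inverse hyperbolic tangent, for -1 < x < 1. *)
Definition atanh (x : R) : R := ln ((1 + x) / (1 - x)) / 2.

(* `|z| is an element of R[i]; this is the same number as an element of R. *)
Definition modulus (z : R[i]) : R := complex.Re `|z|.

Definition datum_modulus (d : datum R[i]^o) : R :=
  match d with
  | Discrete z1 z2 => atanh (modulus ((z1 - z2) / (1 - conjc z2 * z1)))
  | Infinitesimal z v => modulus v / (1 - modulus z ^+ 2)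
  end.

(* The extremal quantities live in \bar R, so that an infimum over the empty
   set is +oo and no boundedness is presupposed. *)
Definition car V (U : set V) (d : datum V) : \bar R :=
  ereal_sup [set (datum_modulus (push F d))%:E | F in holo U (@disc R)].

Definition kob V (U : set V) (d : datum V) : \bar R :=
  ereal_inf [set (datum_modulus zeta)%:E | zeta in
    [set zeta | datum_in (@disc R) zeta /\
                exists2 f, holo (@disc R) U f & push f zeta = d]].

Definition solves_car V (U : set V) (d : datum V) (C : V -> R[i]^o) : Prop :=
  holo U (@disc R) C /\ (datum_modulus (push C d))%:E = car U d.

(* A holomorphic map U -> D is encoded by its extension by 0 outside U, so that
   equality of elements, and hence the cardinality and the proper subsets of a
   set of maps, are those of maps defined on U only. *)
Definition holo_maps V (U : set V) : set (V -> R[i]^o) :=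
  [set F | holo U (@disc R) F /\ forall z, ~ U z -> F z = 0].

Definition universal_set V (U : set V) (S : set (V -> R[i]^o)) : Prop :=
  S `<=` holo_maps U /\
  forall d, datum_in U d -> nondegenerate d ->
    exists2 C, S C & solves_car U d C.

Definition minimal_universal_set V (U : set V) (S : set (V -> R[i]^o)) : Prop :=
  universal_set U S /\ forall S', S' `<` S -> ~ universal_set U S'.

Definition weakly_hyperbolic V (U : set V) : Prop :=
  forall d, datum_in U d -> nondegenerate d -> (0 < car U d)%E.

Definition cvg_locally_uniformly V W (U : set V) (f : nat -> V -> W)
    (g : V -> W) : Prop :=
  forall z, U z -> exists2 N, nbhs z N & {uniform N `&` U, f @ \oo --> g}.

Definition diverges_compactly V W (U : set V) (U' : set W)
    (f : nat -> V -> W) : Prop :=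
  forall (K : set V) (L : set W), compact K -> K `<=` U ->
    compact L -> L `<=` U' -> \forall k \near \oo, f k @` K `&` L = set0.

Definition taut V (U : set V) : Prop :=
  forall f : nat -> R[i]^o -> V, (forall k, holo (@disc R) U (f k)) ->
  exists2 phi : nat -> nat, {homo phi : j k / (j < k)%N} &
    (exists2 g, holo (@disc R) U g &
       cvg_locally_uniformly (@disc R) (f \o phi) g)
    \/ diverges_compactly (@disc R) U (f \o phi).

Definition lempert_domain V (U : set V) : Prop :=
  [/\ domain U, weakly_hyperbolic U, taut U &
      forall d, datum_in U d -> nondegenerate d -> car U d = kob U d].

End Datums.

Arguments disc {R}.
Arguments bidisc {R}.

(* Main.v *)
Require Import Defs.
From mathcomp Require Import ring lra.

(* Proof idea. Every discrete datum (s,t) of a Lempert domain Omega with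
   universal set {A,B} satisfies kob(s,t) = car(s,t) = max of the distances
   between the values of A and between the values of B, so that (A,B) is an
   injective immersion into D^2, whence n <= 2. If the points x_k stay at bounded
   distance from s, there are discs f_k with f_k(0) = s and f_k(c) = x_k for one
   fixed c < 1, and tautness extracts a limit of the x_k in Omega. Hence (A,B) is
   proper; it is onto because at a minimiser of the norm of a Moebius translate
   of (A,B) the differential allows one to decrease this norm unless it is 0.
   For n = 1, an extremal disc of a datum which B does not solve is a holomorphic
   bijection D -> Omega whose inverse is A up to an automorphism of D, so {A}
   alone is universal and {A,B} is not minimal. Conversely on D^2 the two
   coordinates solve everything, by the Schwarz-Pick lemma on the graph of a
   disc map through two given points.

   The Schwarz-Pick lemma is obtained for functions which are merely complex
   differentiable at each point: Goursat's bisection for f(z0 e^w), which is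
   periodic in Im w, gives the mean value property at the centre of a circle,
   hence |f'(0)| <= 1 when f(0) = 0; the distance decreasing property follows by
   integration along a radius. *)

Set Implicit Arguments.
Unset Strict Implicit.
Unset Printing Implicit Defensive.

Import Order.TTheory GRing.Theory Num.Theory.

Local Open Scope classical_set_scope.
Local Open Scope ring_scope.

(** * Goursat bisection on real rectangles *)

(** The Schwarz lemma rests on the quotient f(z)/z, which, filled by f'(0) at 0, is known to be
    continuous there but not differentiable. In the coordinate w with z = z0 e^w the point 0 recedes
    to Re w = -oo: Goursat's argument runs on rectangles that never meet it, and continuity at 0
    enters only when the left side moves off to -oo. The mean of the quotient over a circle controls
    its value f'(0) at the centre and not its other values; this is why |f(z)| <= |z| comes
    afterwards, by integration.

    Universality also concerns infinitesimal datums, whereas discs are compared at two points. The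
    infinitesimal modulus is a limit of quotients of the discrete distance, so inequalities valid
    for all pairs of points pass to tangent vectors.

    In the geometric part compactness is drawn from tautness: it yields minimisers of norms,
    extremal discs and the continuity of the inverse map. *)

Section RealGreen.
Variable R : realType.
Implicit Types (W u v P Q : R -> R -> R) (a b c d x y e : R).

(** For smooth W this is the integral of the mixed second derivative over the rectangle [a,b] x
    [c,d]; it is additive under subdivision. *)
Definition mixdiff W a b c d : R := W b d - W b c - W a d + W a c.

(** The mixed differences of the four quarters add up to that of the whole. The booleans in [q]
    select the lower or the upper half in each direction. *)
Lemma mixdiff_bisect W a b c d m :
  m <= `|mixdiff W a b c d| ->
  exists q : bool * bool,
    m / 4 <= `|mixdiff W (a + (b - a) / 2 * q.1%:R) (a + (b - a) / 2 * q.1%:R + (b - a) / 2)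
                         (c + (d - c) / 2 * q.2%:R) (c + (d - c) / 2 * q.2%:R + (d - c) / 2)|.
Proof.
move=> hm; apply: contrapT => h.
have lt4 (i j : bool) : `|mixdiff W (a + (b - a) / 2 * i%:R) (a + (b - a) / 2 * i%:R + (b - a) / 2)
                         (c + (d - c) / 2 * j%:R) (c + (d - c) / 2 * j%:R + (d - c) / 2)| < m / 4.
  by rewrite ltNge; apply/negP => hh; apply: h; exists (i, j).
have e1 (s t : R) : s + (t - s) / 2 * true%:R + (t - s) / 2 = t by rewrite /=; field.
have e0 (s t : R) : s + (t - s) / 2 * true%:R = s + (t - s) / 2 by rewrite /=; field.
have e2 (s t : R) : s + (t - s) / 2 * false%:R = s by rewrite /=; field.
have := lt4 true true; have := lt4 true false; have := lt4 false true; have := lt4 false false.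
rewrite !e1 !e2 !e0 => h1 h2 h3 h4.
suff : `|mixdiff W a b c d| < m by move=> h5; move: (lt_le_trans h5 hm); rewrite ltxx.
set p := a + _ in h1 h2 h3 h4; set q := c + _ in h1 h2 h3 h4.
have -> : mixdiff W a b c d = mixdiff W a p c q + mixdiff W a p q d +
          mixdiff W p b c q + mixdiff W p b q d by rewrite /mixdiff; ring.
apply: le_lt_trans (ler_normD _ _) _.
have := ler_normD (mixdiff W a p c q + mixdiff W a p q d) (mixdiff W p b c q).
have := ler_normD (mixdiff W a p c q) (mixdiff W a p q d).
lra.
Qed.

Lemma nested_intervals (s w : nat -> R) :
  (forall k, s k <= s k.+1) -> (forall k, s k.+1 + w k.+1 <= s k + w k) ->
  (forall k, 0 <= w k) -> exists x, forall k, s k <= x <= s k + w k.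
Proof.
move=> s1 w1 w0.
have smon j k : (j <= k)%N -> s j <= s k.
  by elim: k => [|k IH]; [rewrite leqn0 => /eqP -> | rewrite leq_eqVlt => /predU1P[->//|/IH/le_trans]; apply].
have wmon j k : (j <= k)%N -> s k + w k <= s j + w j.
  elim: k => [|k IH]; first by rewrite leqn0 => /eqP ->.
  by rewrite leq_eqVlt => /predU1P[->//|/IH]; apply: le_trans.
have ub j k : s j <= s k + w k.
  case: (leqP j k) => [jk|/ltnW kj].
    by apply: le_trans (smon _ _ jk) _; rewrite lerDl.
  by apply: le_trans (wmon _ _ kj); rewrite lerDl.
have ne : (range s) !=set0 by exists (s 0%N); exists 0%N.
exists (sup (range s)) => k; apply/andP; split.
  apply: ub_le_sup; last by exists k.
  by exists (s 0%N + w 0%N) => _ [j _ <-].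
by apply: ge_sup => // _ [j _ <-].
Qed.

(** Repeated bisection keeps a mixed difference of at least m / 4^k on a rectangle of size L / 2^k
    shrinking to a point, which contradicts an error quadratic in the size with a small factor
    [e]. *)
Lemma mixdiff_eq0 W a b c d : a <= b -> c <= d ->
  (forall x y, a <= x <= b -> c <= y <= d -> forall e, 0 < e ->
     exists2 r, 0 < r & forall a' b' c' d',
       a <= a' -> a' <= x <= b' -> b' <= b ->
       c <= c' -> c' <= y <= d' -> d' <= d -> b' - a' < r -> d' - c' < r ->
       `|mixdiff W a' b' c' d'| <= e * ((b' - a') + (d' - c')) ^+ 2) ->
  mixdiff W a b c d = 0.
Proof.
move=> ab cd H; apply/eqP; rewrite -normr_le0 leNgt; apply/negP => m0.
set m := `|_| in m0.
pose A (k : nat) := (b - a) / 2 ^+ k; pose C (k : nat) := (d - c) / 2 ^+ k.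
have pow k : (0 : R) < 2 ^+ k by rewrite exprn_gt0.
have AS k : A k.+1 = A k / 2 by rewrite /A exprS; field; rewrite gt_eqF.
have CS k : C k.+1 = C k / 2 by rewrite /C exprS; field; rewrite gt_eqF.
have A0 k : 0 <= A k by rewrite /A divr_ge0 ?subr_ge0 // ltW.
have C0 k : 0 <= C k by rewrite /C divr_ge0 ?subr_ge0 // ltW.
pose D k (p : R * R) := `|mixdiff W p.1 (p.1 + A k) p.2 (p.2 + C k)|.
pose nxt k (p : R * R) (q : bool * bool) := (p.1 + A k / 2 * q.1%:R, p.2 + C k / 2 * q.2%:R).
pose good k p q := m / 4 ^+ k.+1 <= D k.+1 (nxt k p q).
have ex k p : m / 4 ^+ k <= D k p -> exists q, good k p q.
  move=> /mixdiff_bisect [q hq]; exists q; rewrite /good /D /nxt /= AS CS.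
  move: hq; rewrite (addrAC p.1) subrr add0r (addrAC p.2) subrr add0r.
  by rewrite exprSr invfM mulrA.
(* The default [(false, false)] is never taken: [sD] shows by induction that some quarter is good at
   each stage. *)
pose s := fix s k := if k is j.+1 then nxt j (s j) (xget (false, false) (good j (s j))) else (a, c).
have sD k : m / 4 ^+ k <= D k (s k).
  elim: k => [|k /ex [q hq]].
    by rewrite /D /A /C /= !expr0 !divr1 !(addrC _ (_ - _)) !subrK.
  exact: (@xgetI _ (false, false) (fun q => good k (s k) q) q hq).
have sS k : exists q, s k.+1 = nxt k (s k) q by eexists.
have hb (q : bool) : (0 <= q%:R :> R) && (q%:R <= 1 :> R) by case: q; rewrite /= ?lexx ?ler01.
have n1 : (forall k, (s k).1 <= (s k.+1).1).
  by move=> k; have [q ->] := sS k; rewrite /nxt /=; have := A0 k; have := hb q.1; nra.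
have n2 : (forall k, (s k).2 <= (s k.+1).2).
  by move=> k; have [q ->] := sS k; rewrite /nxt /=; have := C0 k; have := hb q.2; nra.
have n3 : (forall k, (s k.+1).1 + A k.+1 <= (s k).1 + A k).
  by move=> k; have [q ->] := sS k; rewrite AS /nxt /=; have := A0 k; have := hb q.1; nra.
have n4 : (forall k, (s k.+1).2 + C k.+1 <= (s k).2 + C k).
  by move=> k; have [q ->] := sS k; rewrite CS /nxt /=; have := C0 k; have := hb q.2; nra.
have [x hx] := nested_intervals n1 n3 A0.
have [y hy] := nested_intervals n2 n4 C0.
have hx0 : a <= x <= b by have := hx 0%N; rewrite /A expr0 divr1 /= addrCA subrr addr0.
have hy0 : c <= y <= d by have := hy 0%N; rewrite /C expr0 divr1 /= addrCA subrr addr0.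
pose L := (b - a) + (d - c).
have L0 : 0 <= L by rewrite /L; lra.
(* Chosen so that e L^2 < m; the + 1 covers a degenerate rectangle with L = 0. *)
pose e := m / (2 * (L ^+ 2 + 1)).
have L20 : 0 < L ^+ 2 + 1 by have := sqr_ge0 L; lra.
have e0 : 0 < e by rewrite /e divr_gt0 // mulr_gt0.
have [r r0 hr] := H x y hx0 hy0 e e0.
have [k hk] : exists k : nat, L < r * 2 ^+ k.
  exists (Num.truncn (L / r)).+1.
  rewrite mulrC -ltr_pdivrMr //.
  apply: lt_le_trans (truncnS_gt _) _.
  have := @ltn_expl 2 (Num.truncn (L / r)).+1 isT.
  by move=> /ltnW; rewrite -(ler_nat R) natrX.
have smon j : a <= (s j).1 /\ (s j).1 + A j <= b.
  elim: j => [|j [i1 i2]]; first by rewrite /A expr0 divr1 /=; lra.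
  by have := n1 j; have := n3 j; lra.
have smon2 j : c <= (s j).2 /\ (s j).2 + C j <= d.
  elim: j => [|j [i1 i2]]; first by rewrite /C expr0 divr1 /=; lra.
  by have := n2 j; have := n4 j; lra.
have AL : A k <= L / 2 ^+ k by rewrite /A ler_pM2r ?invr_gt0 //; rewrite /L; lra.
have CL : C k <= L / 2 ^+ k by rewrite /C ler_pM2r ?invr_gt0 //; rewrite /L; lra.
have Lr : L / 2 ^+ k < r by rewrite ltr_pdivrMr.
have [m1 m2] := smon k; have [m3 m4] := smon2 k.
have := hr (s k).1 ((s k).1 + A k) (s k).2 ((s k).2 + C k) m1 (hx k) m2 m3 (hy k) m4.
rewrite !(addrAC _ (A k)) !(addrAC _ (C k)) !subrr !add0r => hh.
have := hh (le_lt_trans AL Lr) (le_lt_trans CL Lr).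
move: (sD k); rewrite /D => /le_trans /[apply].
have -> : C k + A k = L / 2 ^+ k by rewrite /A /C /L -mulrDl; congr (_ / _); rewrite addrC.
rewrite expr_div_n -exprM mulnC exprM.
have -> : (2 ^+ 2 : R) = 4 by ring.
rewrite mulrA ler_pM2r ?invr_gt0 ?exprn_gt0 // /e.
apply/negP; rewrite -ltNge.
rewrite mulrAC ltr_pdivrMr ?mulr_gt0 //.
by have := sqr_ge0 L; nra.
Qed.

Lemma mvt_bound (f df : R -> R) M a b : a <= b ->
  (forall x, a <= x <= b -> is_derive x 1 f (df x)) ->
  (forall x, a <= x <= b -> `|df x| <= M) -> `|f b - f a| <= M * (b - a).
Proof.
move=> ab hf hM.
have hf' x : x \in `]a, b[ -> is_derive x 1 f (df x).
  by rewrite in_itv /= => /andP[/ltW ax /ltW xb]; apply: hf; rewrite ax.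
have cf : {within `[a, b], continuous f}.
  apply: derivable_within_continuous => x; rewrite in_itv /= => /hf h.
  exact: ex_derive.
have [c cab ->] := MVT_segment ab hf' cf.
rewrite normrM (ger0_norm (_ : 0 <= b - a)) ?subr_ge0 //.
by rewrite ler_wpM2r ?subr_ge0 // hM //; move: cab; rewrite in_itv.
Qed.

Let sub a a' b' b x : a <= a' -> b' <= b -> a' <= x <= b' -> a <= x <= b.
Proof. by move=> h1 h2 /andP[/(le_trans h1) -> /le_trans ->]. Qed.

(* The mixed difference of [P - Q] is the circulation of [v dx + u dy] around
   the rectangle, so this is Goursat's lemma for the real part of a
   holomorphic 1-form, with integrals replaced by primitives. *)
Lemma green_goursat u v P Q a b c d : a <= b -> c <= d ->
  (forall x y, a <= x <= b -> c <= y <= d -> is_derive y 1 (P x) (u x y)) ->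
  (forall x y, a <= x <= b -> c <= y <= d -> is_derive x 1 (Q ^~ y) (v x y)) ->
  (forall x0 y0, a <= x0 <= b -> c <= y0 <= d ->
     exists al be ga : R, forall e, 0 < e -> exists2 r, 0 < r &
       forall x y, a <= x <= b -> c <= y <= d -> `|x - x0| < r -> `|y - y0| < r ->
       `|u x y - u x0 y0 - al * (x - x0) - be * (y - y0)| <= e * (`|x - x0| + `|y - y0|) /\
       `|v x y - v x0 y0 - ga * (x - x0) - al * (y - y0)| <= e * (`|x - x0| + `|y - y0|)) ->
  mixdiff P a b c d = mixdiff Q a b c d.
Proof.
move=> ab cd hP hQ H.
suff : mixdiff (fun x y => P x y - Q x y) a b c d = 0 by rewrite /mixdiff; lra.
apply: mixdiff_eq0 => // x0 y0 hx0 hy0 e e0.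
have [al [be [ga /(_ (e / 4))]]] := H x0 y0 hx0 hy0.
move=> [|r r0 hr]; first by lra.
exists r => // a' b' c' d' aa' /andP[ax xb] bb' cc' /andP[cy yd] dd' hb hd.
set s := b' - a' + _.
have s0 : 0 <= s by rewrite /s; lra.
have nx x : a' <= x <= b' -> `|x - x0| <= b' - a' by move=> hx; rewrite ler_norml; lra.
have ny y : c' <= y <= d' -> `|y - y0| <= d' - c' by move=> hy; rewrite ler_norml; lra.
have key x y : a' <= x <= b' -> c' <= y <= d' ->
    `|u x y - u x0 y0 - al * (x - x0) - be * (y - y0)| <= e / 4 * s /\
    `|v x y - v x0 y0 - ga * (x - x0) - al * (y - y0)| <= e / 4 * s.
  move=> hx hy; have h1 := nx _ hx; have h2 := ny _ hy.
  have [k1 k2] := hr x y (sub aa' bb' hx) (sub cc' dd' hy) (le_lt_trans h1 hb) (le_lt_trans h2 hd).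
  have h3 : e / 4 * (`|x - x0| + `|y - y0|) <= e / 4 * s.
    by rewrite ler_pM2l ?divr_gt0 // /s lerD.
  by split; [apply: le_trans k1 h3 | apply: le_trans k2 h3].
have ia : a' <= a' <= b' by rewrite lexx (le_trans ax xb).
have ib : a' <= b' <= b' by rewrite lexx (le_trans ax xb).
have ic : c' <= c' <= d' by rewrite lexx (le_trans cy yd).
have id : c' <= d' <= d' by rewrite lexx (le_trans cy yd).
(* The Cauchy-Riemann equation is the common coefficient [al]: the linear terms subtracted in [f]
   and in [g] both contribute al (b' - a') (d' - c') and cancel in the mixed difference. The terms
   in [be] and [ga] cancel within each difference of [u] or of [v], leaving two errors of size e / 4
   * s. *)
pose f y := P b' y - P a' y - al * (b' - a') * y.
pose g x := Q x d' - Q x c' - al * (d' - c') * x.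
have hf : `|f d' - f c'| <= (e / 2 * s) * (d' - c').
  apply: (@mvt_bound f (fun y => u b' y - u a' y - al * (b' - a'))); first by exact: le_trans cy yd.
    move=> y /(sub cc' dd') hy.
    have -> : f = (P b' - P a') - (al * (b' - a')) *: (@idfun R) by [].
    have ? := hP b' y (sub aa' bb' ib) hy; have ? := hP a' y (sub aa' bb' ia) hy.
    by apply: is_derive_eq; rewrite /GRing.scale /= mulr1.
  clear H hr hP hQ nx ny.
  move=> y hy; have [+ _] := key _ _ ia hy; have [+ _] := key _ _ ib hy.
  by rewrite !ler_norml; lra.
have hg : `|g b' - g a'| <= (e / 2 * s) * (b' - a').
  apply: (@mvt_bound g (fun x => v x d' - v x c' - al * (d' - c'))); first by exact: le_trans ax xb.
    move=> x /(sub aa' bb') hx.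
    have -> : g = (Q ^~ d' - Q ^~ c') - (al * (d' - c')) *: (@idfun R) by [].
    have ? := hQ x d' hx (sub cc' dd' id); have ? := hQ x c' hx (sub cc' dd' ic).
    by apply: is_derive_eq; rewrite /GRing.scale /= mulr1.
  clear H hr hP hQ nx ny.
  move=> x hx; have [_ +] := key _ _ hx ic; have [_ +] := key _ _ hx id.
  by rewrite !ler_norml; lra.
have -> : mixdiff (fun x y => P x y - Q x y) a' b' c' d' = (f d' - f c') - (g b' - g a').
  by rewrite /mixdiff /f /g; ring.
apply: le_trans (ler_normB _ _) _.
clear H hr hP hQ nx ny key.
have h1 : e / 2 * s * (d' - c') <= e / 2 * s * s by rewrite ler_wpM2l ?mulr_ge0 //; rewrite /s; lra.
have h2 : e / 2 * s * (b' - a') <= e / 2 * s * s by rewrite ler_wpM2l ?mulr_ge0 //; rewrite /s; lra.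
rewrite expr2; lra.
Qed.

Lemma primitive_exists (f : R -> R) a : continuous f ->
  exists F : R -> R, forall x, a < x -> is_derive x 1 F (f x).
Proof.
move=> cf.
exists (fun x => \int[lebesgue_measure]_(t in [set` `[a, x]]) f t)%R => x ax.
have [] := @continuous_FTC1_closed R f a x (x + 1) _ _ ax (cf x).
- by rewrite ltrDl.
- apply: continuous_compact_integrable; first exact: segment_compact.
  exact: continuous_subspaceT.
- by move=> d <-; rewrite derive1E; apply: derivableP.
Qed.

End RealGreen.

(** * Real-valued norms *)

Section ComplexNorm.
Variable R : realType.
Implicit Types (V W : normedModType R[i]).
Local Notation C := R[i].

(* The library norm of a normed module over R[i] is an element of R[i]. *)
Definition nrm V (v : V) : R := complex.Re `|v|.

Lemma nrmE V (v : V) : `|v| = (nrm v)%:C%C.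
Proof. by rewrite /nrm RRe_real // ger0_real. Qed.

Lemma ltc_nrm V (v : V) (r : R) : (`|v| < r%:C%C) = (nrm v < r).
Proof. by rewrite nrmE ltcR. Qed.

Lemma nrm_ge0 V (v : V) : 0 <= nrm v.
Proof. by have := normr_ge0 v; rewrite nrmE ler0c. Qed.

Lemma nrm0 V : nrm (0 : V) = 0.
Proof. by rewrite /nrm normr0. Qed.

Lemma nrm_eq0 V (v : V) : (nrm v == 0) = (v == 0).
Proof.
apply/idP/idP => [/eqP h|/eqP ->]; last by rewrite nrm0.
by rewrite -normr_eq0 nrmE h.
Qed.

Lemma nrm_gt0 V (v : V) : (0 < nrm v) = (v != 0).
Proof. by rewrite lt_def nrm_ge0 andbT nrm_eq0. Qed.

Lemma nrmD V (v w : V) : nrm (v + w) <= nrm v + nrm w.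
Proof. by rewrite -lecR rmorphD /= -!nrmE ler_normD. Qed.

Lemma nrmN V (v : V) : nrm (- v) = nrm v.
Proof. by rewrite /nrm normrN. Qed.

Lemma nrmBC V (v w : V) : nrm (v - w) = nrm (w - v).
Proof. by rewrite -nrmN opprB. Qed.

Lemma nrmB V (v w : V) : nrm (v - w) <= nrm v + nrm w.
Proof. by rewrite -(nrmN w) nrmD. Qed.

Lemma nrmB_dist V (v w : V) : nrm v - nrm w <= nrm (v - w).
Proof. by rewrite lerBlDr; apply: le_trans (nrmD _ _); rewrite subrK. Qed.

Lemma nrmZ V (k : C) (v : V) : nrm (k *: v) = modulus k * nrm v.
Proof.
by apply: complexI; rewrite rmorphM /= -!nrmE normrZ /modulus RRe_real ?ger0_real.
Qed.

Lemma modulusM (z w : C) : modulus (z * w) = modulus z * modulus w.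
Proof. exact: (@nrmZ (C^o : normedModType C)). Qed.

Lemma modulus_ge0 (z : C) : 0 <= modulus z.
Proof. exact: (@nrm_ge0 C^o). Qed.

Lemma modulus_eq0 (z : C) : (modulus z == 0) = (z == 0).
Proof. exact: (@nrm_eq0 C^o). Qed.

Lemma modulus_gt0 (z : C) : (0 < modulus z) = (z != 0).
Proof. exact: (@nrm_gt0 C^o). Qed.

Lemma modulus0 : modulus (0 : C) = 0.
Proof. exact: (@nrm0 C^o). Qed.

Lemma modulusD (z w : C) : modulus (z + w) <= modulus z + modulus w.
Proof. exact: (@nrmD C^o). Qed.

Lemma modulusN (z : C) : modulus (- z) = modulus z.
Proof. exact: (@nrmN C^o). Qed.

Lemma modulusB (z w : C) : modulus (z - w) <= modulus z + modulus w.
Proof. exact: (@nrmB C^o). Qed.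

Lemma modulusBC (z w : C) : modulus (z - w) = modulus (w - z).
Proof. exact: (@nrmBC C^o). Qed.

Lemma modulusB_dist (z w : C) : modulus z - modulus w <= modulus (z - w).
Proof. exact: (@nrmB_dist C^o). Qed.

Lemma modulus1 : modulus (1 : C) = 1.
Proof. by rewrite /modulus normr1. Qed.

Lemma modulus_real (x : R) : modulus (x%:C%C : C) = `|x|.
Proof.
rewrite /modulus normc_def /= expr0n addr0 sqrtr_sqr //.
Qed.

Lemma modulusE (z : C) : (modulus z)%:C%C = `|z|.
Proof. by rewrite /modulus RRe_real ?ger0_real. Qed.

Lemma modulusV (z : C) : modulus z^-1 = (modulus z)^-1.
Proof.
by apply: complexI; rewrite fmorphV /= !modulusE normfV.
Qed.

Lemma modulus_div (z w : C) : modulus (z / w) = modulus z / modulus w.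
Proof. by rewrite modulusM modulusV. Qed.

Lemma modulus_conj (z : C) : modulus (conjc z) = modulus z.
Proof. by rewrite /modulus normcJ. Qed.

Lemma sqr_modulus (z : C) : modulus z ^+ 2 = complex.Re z ^+ 2 + complex.Im z ^+ 2.
Proof. by rewrite /modulus normc_def /= sqr_sqrtr // addr_ge0 ?sqr_ge0. Qed.

Lemma mulr_conj (z : C) : z * conjc z = (modulus z ^+ 2)%:C%C.
Proof. by rewrite rmorphXn /= modulusE sqr_normc. Qed.

Lemma Re_le_modulus (z : C) : `|complex.Re z| <= modulus z.
Proof. by have := normc_ge_Re z; rewrite -[`|z|]/(`|(z : C^o)|) nrmE lecR. Qed.

Lemma Im_le_modulus (z : C) : `|complex.Im z| <= modulus z.
Proof.
rewrite -(ler_pXn2r (_ : 0 < 2)%N) ?nnegrE ?modulus_ge0 //.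
by rewrite sqr_modulus real_normK ?num_real // lerDr sqr_ge0.
Qed.

Lemma modulus_le_ReIm (z : C) : modulus z <= `|complex.Re z| + `|complex.Im z|.
Proof.
rewrite -(ler_pXn2r (_ : 0 < 2)%N) ?nnegrE ?addr_ge0 ?modulus_ge0 //.
rewrite sqr_modulus sqrrD !real_normK ?num_real //.
by rewrite addrAC lerDl mulrn_wge0 // mulr_ge0.
Qed.

Lemma discE (z : C^o) : disc z <-> modulus z < 1.
Proof. by rewrite /disc /= -[1]/(1%:C%C) ltc_nrm. Qed.

Lemma nbhs_nrmP V (x : V) (A : set V) :
  nbhs x A <-> exists2 r : R, 0 < r & forall y, nrm (y - x) < r -> A y.
Proof.
split.
  move/nbhs_normP => [e /= e0 he]; exists (complex.Re e).
    by move: e0; rewrite ltcE => /andP[].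
  move=> y hy; apply: he; rewrite /ball_ /= distrC.
  by rewrite -[e]RRe_real ?ger0_real ?ltW // ltc_nrm.
move=> [r r0 h]; apply/nbhs_normP; exists (r%:C%C); first by rewrite /= ltcR.
by move=> y; rewrite /ball_ /= distrC ltc_nrm; apply: h.
Qed.

Lemma differentiable_nrm V W (f : V -> W) x : differentiable f x ->
  forall e : R, 0 < e -> exists2 r : R, 0 < r &
    forall h, nrm h < r -> nrm (f (x + h) - f x - 'd f x h) <= e * nrm h.
Proof.
move=> /diff_locally /eqaddoP h e e0.
have /h/nbhs_nrmP [r r0 hr] : 0 < e%:C%C :> C by rewrite ltcR.
exists r => // k kr; have := hr k; rewrite subr0 => /(_ kr) /=.
by rewrite nrmE nrmE -rmorphM lecR /= !fctE /= opprD addrA (addrC k).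
Qed.

(** Serves where a differential is produced by hand: for maps that agree near a point, for
    translates, and for the inverse map onto the bidisc. *)
Lemma nrm_differentiable V W (f : V -> W) x (df : {linear V -> W}) :
  continuous df ->
  (forall e : R, 0 < e -> exists2 r : R, 0 < r &
    forall h, nrm h < r -> nrm (f (x + h) - f x - df h) <= e * nrm h) ->
  differentiable f x /\ 'd f x = df :> (V -> W).
Proof.
move=> cdf H.
have E : f \o shift x = cst (f x) + df +o_ 0 id.
  apply/eqaddoP => e e0.
  have [|r r0 hr] := H (complex.Re e).
    by move: e0; rewrite ltcE => /andP[].
  apply/nbhs_nrmP; exists r => // k; rewrite subr0 => /hr /=.
  rewrite /= !fctE opprD addrA (addrC k).
  by rewrite nrmE (nrmE k) -(RRe_real (ger0_real (ltW e0))) -rmorphM lecR /=.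
have D := diff_unique cdf E.
by split => //; apply/diff_locallyP; rewrite D.
Qed.

End ComplexNorm.

(** * Mean value property *)

Section MeanValue.
Variable R : realType.
Local Notation C := R[i].

Lemma is_derive_expansionP (f : R -> R) (x d : R) :
  is_derive x 1 f d <->
  forall e, 0 < e -> exists2 r, 0 < r &
    forall y, `|y - x| < r -> `|f y - f x - d * (y - x)| <= e * `|y - x|.
Proof.
split=> [h e e0|H].
  have /derivable1_diffP df : derivable f x 1 by exact: ex_derive.
  have := diff_locally df => /eqaddoP /(_ _ e0) /nbhs_normP [r /= r0 hr].
  exists r => // y yr; have := hr (y - x).
  rewrite /ball_ /= sub0r normrN => /(_ yr); rewrite !fctE /= subrK opprD addrA.
  by rewrite deriv1E // derive1E derive_val /GRing.scale /= mulrC.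
pose df : {linear R -> R} := GRing.scale d.
have cdf : continuous df by move=> y; apply: continuousZr; exact: cvg_id.
have E : f \o shift x = cst (f x) + df +o_ 0 id.
  apply/eqaddoP => e e0; have [r r0 hr] := H e e0.
  apply/nbhs_normP; exists r => // y; rewrite /ball_ /= sub0r normrN => yr.
  have := hr (y + x); rewrite addrK => /(_ yr).
  by rewrite !fctE /= opprD addrA.
have D := diff_unique cdf E.
have dff : differentiable f x by apply/diff_locallyP; rewrite D.
apply: DeriveDef; first exact: diff_derivable.
by rewrite deriveE // D /= /GRing.scale /= mulr1.
Qed.

(** This is e^(x + iy), kept as a function of two real variables because Goursat's argument is run
    on real rectangles. *)
Definition cexp (x y : R) : C := Complex (expR x * cos y) (expR x * sin y).

Lemma cexp0 : cexp 0 0 = 1.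
Proof. by rewrite /cexp expR0 cos0 sin0 mulr1 mulr0. Qed.

Lemma cexpD x y s t : cexp (x + s) (y + t) = cexp x y * cexp s t.
Proof.
by apply/eqP; rewrite eq_complex /= expRD cosD sinD; apply/andP; split; apply/eqP; ring.
Qed.

Lemma cexp_2pi x : cexp x (2 * pi) = cexp x 0.
Proof. by rewrite /cexp mulr_natl cos2pi sin2pi cos0 sin0. Qed.

Lemma modulus_cexp x y : modulus (cexp x y) = expR x.
Proof.
apply/eqP; rewrite -(eqrXn2 (_ : 0 < 2)%N) ?expR_ge0 ?modulus_ge0 //.
by rewrite sqr_modulus /= !exprMn -mulrDr cos2Dsin2 mulr1.
Qed.

Lemma cexp_expansion (e : R) : 0 < e -> exists2 r, 0 < r & forall s t,
  `|s| < r -> `|t| < r ->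
  modulus (cexp s t - 1 - Complex s t) <= e * (`|s| + `|t|).
Proof.
(* The 5 counts the errors in |t|: two from the real part, two from the imaginary part, and one from
   the product s t. *)
move=> e0; have [e' e'0 j4] : exists2 e', 0 < e' & e = 5 * e'.
  by exists (e / 5); [rewrite divr_gt0 | field].
have /is_derive_expansionP /(_ _ e'0) [r1 r10 h1] := is_derive_expR (0 : R).
have /is_derive_expansionP /(_ _ e'0) [r2 r20 h2] := is_derive_cos (0 : R).
have /is_derive_expansionP /(_ _ e'0) [r3 r30 h3] := is_derive_sin (0 : R).
exists (Num.min 1 (Num.min e' (Num.min r1 (Num.min r2 r3)))); first by rewrite !lt_min ltr01 e'0 r10 r20 r30.
move=> s t; rewrite !lt_min => /and5P[s1 se sr _ _] /and5P[t1 te _ tr2 tr3].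
apply: le_trans (modulus_le_ReIm _) _; rewrite /=.
have {h1} := h1 s; have {h2} := h2 t; have {h3} := h3 t; rewrite !subr0.
rewrite expR0 cos0 sin0 mul1r oppr0 mul0r !subr0 addr0 mul1r => /(_ tr3) h3 /(_ tr2) h2 /(_ sr) h1.
have c1 : `|cos t| <= 1 := cos_max t.
have si1 : `|sin t| <= 1 := sin_max t.
have -> : expR s * cos t - 1 - s = (expR s - 1 - s) * cos t + (1 + s) * (cos t - 1) by ring.
have -> : expR s * sin t - t = (expR s - 1 - s) * sin t + (1 + s) * (sin t - t) + s * t by ring.
have hs2 : `|1 + s| <= 2 by apply: le_trans (ler_normD _ _) _; rewrite normr1; lra.
have i1 : `|(expR s - 1 - s) * cos t| <= e' * `|s|.
  by rewrite normrM -[leRHS]mulr1 ler_pM.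
have i2 : `|(expR s - 1 - s) * sin t| <= e' * `|s|.
  by rewrite normrM -[leRHS]mulr1 ler_pM.
have i3 : `|(1 + s) * (cos t - 1)| <= 2 * (e' * `|t|) by rewrite normrM ler_pM.
have i4 : `|(1 + s) * (sin t - t)| <= 2 * (e' * `|t|) by rewrite normrM ler_pM.
have i5 : `|s * t| <= e' * `|t| by rewrite normrM ler_wpM2r // ltW.
have j1 := ler_normD ((expR s - 1 - s) * cos t) ((1 + s) * (cos t - 1)).
have j2 := ler_normD ((expR s - 1 - s) * sin t + (1 + s) * (sin t - t)) (s * t).
have j3 := ler_normD ((expR s - 1 - s) * sin t) ((1 + s) * (sin t - t)).
have i6 : 0 <= e' * `|s| by rewrite mulr_ge0 // ltW.
rewrite j4; move: j1 j2 j3 i1 i2 i3 i4 i5 i6; clear; lra.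
Qed.

Definition cderiv (g : C -> C) (z c : C) := forall e : R, 0 < e ->
  exists2 r : R, 0 < r & forall h, modulus h < r ->
    modulus (g (z + h) - g z - c * h) <= e * modulus h.

(** Chain rule for w |-> g(z0 e^w), whose derivative is c z. Half of [e] pays for the expansion of
    [g], half for that of the exponential. *)
Lemma cderiv_cexp (g : C -> C) (z0 c : C) (x0 y0 : R) :
  cderiv g (z0 * cexp x0 y0) c ->
  forall e : R, 0 < e -> exists2 r : R, 0 < r & forall x y,
    `|x - x0| < r -> `|y - y0| < r ->
    modulus (g (z0 * cexp x y) - g (z0 * cexp x0 y0)
             - c * (z0 * cexp x0 y0) * Complex (x - x0) (y - y0))
      <= e * (`|x - x0| + `|y - y0|).
Proof.
set z := z0 * cexp x0 y0 => H e e0.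
pose m := modulus z + 1; have m0 : 0 < m by rewrite ltr_wpDl ?modulus_ge0.
pose k := modulus c + 1; have k0 : 0 < k by rewrite ltr_wpDl ?modulus_ge0.
have [|r1 r10 h1] := H (e / (4 * m)); first by rewrite divr_gt0 // mulr_gt0.
pose e' := Num.min 1 (e / (2 * m * k)).
have e'0 : 0 < e' by rewrite lt_min ltr01 divr_gt0 // !mulr_gt0.
have [r2 r20 h2] := cexp_expansion e'0.
pose r3 := r1 / (4 * m); have r30 : 0 < r3 by rewrite divr_gt0 // mulr_gt0.
exists (Num.min r2 r3); first by rewrite lt_min r20.
move=> x y; rewrite !lt_min => /andP[x2 x3] /andP[y2 y3].
have E := h2 _ _ x2 y2.
set s := x - x0 in x2 x3 E *; set t := y - y0 in y2 y3 E *.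
set w := Complex s t in E *; set N := `|s| + `|t| in E *.
have N0 : 0 <= N by rewrite addr_ge0.
have wN : modulus w <= N := modulus_le_ReIm w.
have -> : z0 * cexp x y = z + z * (cexp s t - 1).
  by rewrite mulrBr mulr1 addrC subrK /z -mulrA -cexpD /s /t !(addrC _ (_ - _)) !subrK.
set q := cexp s t - 1 in E *.
have qN : modulus q <= 2 * N.
  rewrite -(subrK w q); apply: le_trans (modulusD _ _) _.
  have : e' * N <= N by rewrite ler_piMl // ge_min lexx.
  lra.
have zq : modulus (z * q) <= m * (2 * N).
  by rewrite modulusM ler_pM ?modulus_ge0 // lerDl.
have zqr : modulus (z * q) < r1.
  apply: le_lt_trans zq _.
  have : N < 2 * r3 by rewrite /N mulr_natl mulr2n ltrD.
  rewrite /r3 => h; have := h; rewrite -(ltr_pM2l m0) => h'.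
  have : m * (2 * (r1 / (4 * m))) = r1 / 2 by field; rewrite gt_eqF.
  lra.
have := h1 _ zqr.
have -> : g (z + z * q) - g z - c * z * w = (g (z + z * q) - g z - c * (z * q)) + c * z * (q - w) by ring.
move=> j1; apply: le_trans (modulusD _ _) _.
have j2 : modulus (c * z * (q - w)) <= k * m * (e' * N).
  rewrite modulusM (modulusM c z) ler_pM ?mulr_ge0 ?modulus_ge0 //.
  by rewrite ler_pM ?modulus_ge0 // lerDl.
have j3 : k * m * (e' * N) <= e / 2 * N.
  rewrite mulrA ler_wpM2r //.
  have -> : e / 2 = k * m * (e / (2 * m * k)) by field; rewrite !gt_eqF.
  by rewrite ler_pM2l ?mulr_gt0 // ge_min lexx orbT.
have j4 : e / (4 * m) * modulus (z * q) <= e / 2 * N.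
  have -> : e / 2 * N = e / (4 * m) * (m * (2 * N)) by field; rewrite gt_eqF.
  by rewrite ler_pM2l // divr_gt0 // mulr_gt0.
lra.
Qed.

(** Multiplication by a complex number has equal diagonal entries as a real matrix, hence the same
    [al] in both expansions, as [green_goursat] requires. *)
Lemma cderiv_cexp_ReIm (g : C -> C) (z0 c : C) (x0 y0 : R) :
  cderiv g (z0 * cexp x0 y0) c ->
  exists al be ga : R, forall e, 0 < e -> exists2 r, 0 < r & forall x y,
    `|x - x0| < r -> `|y - y0| < r ->
    `|complex.Re (g (z0 * cexp x y)) - complex.Re (g (z0 * cexp x0 y0))
        - al * (x - x0) - be * (y - y0)| <= e * (`|x - x0| + `|y - y0|) /\
    `|complex.Im (g (z0 * cexp x y)) - complex.Im (g (z0 * cexp x0 y0))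
        - ga * (x - x0) - al * (y - y0)| <= e * (`|x - x0| + `|y - y0|).
Proof.
move=> /cderiv_cexp H; set w := c * (z0 * cexp x0 y0) in H.
exists (complex.Re w), (- complex.Im w), (complex.Im w) => e /H [r r0 hr].
exists r => // x y /hr /[apply]; move: (g _) (g _) => [a1 a2] [b1 b2].
case: w {H hr} => p q h; split.
  apply: le_trans h; apply: le_trans (Re_le_modulus _); rewrite /=.
  by rewrite le_eqVlt; apply/orP; left; apply/eqP; congr (`|_|); ring.
apply: le_trans h; apply: le_trans (Im_le_modulus _); rewrite /=.
by rewrite le_eqVlt; apply/orP; left; apply/eqP; congr (`|_|); ring.
Qed.

(* [F] is a primitive of [y |-> Re g(z0 e^(iy))], so the second clause is the
   mean value property on the circle through [z0]. *)
Lemma mean_value (g : C -> C) (z0 : C) :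
  (forall z, z != 0 -> modulus z <= modulus z0 -> exists c, cderiv g z c) ->
  (forall e : R, 0 < e -> exists2 r : R, 0 < r & forall z, modulus z < r ->
     modulus (g z - g 0) <= e) ->
  z0 != 0 ->
  exists2 F : R -> R,
    (forall y : R, 0 <= y <= 2 * pi -> is_derive y 1 F (complex.Re (g (z0 * cexp 0 y)))) &
    F (2 * pi) - F 0 = 2 * pi * complex.Re (g 0).
Proof.
move=> dg cg z0N.
pose u x y := complex.Re (g (z0 * cexp x y)).
pose v x y := complex.Im (g (z0 * cexp x y)).
have z0p : 0 < modulus z0 by rewrite modulus_gt0.
have K (x0 y0 : R) : x0 <= 0 -> exists al be ga : R, forall e, 0 < e -> exists2 r, 0 < r & forall x y,
    `|x - x0| < r -> `|y - y0| < r ->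
    `|u x y - u x0 y0 - al * (x - x0) - be * (y - y0)| <= e * (`|x - x0| + `|y - y0|) /\
    `|v x y - v x0 y0 - ga * (x - x0) - al * (y - y0)| <= e * (`|x - x0| + `|y - y0|).
  move=> x00; have [||c /cderiv_cexp_ReIm //] := dg (z0 * cexp x0 y0).
    by rewrite -modulus_gt0 modulusM modulus_cexp mulr_gt0 // expR_gt0.
  by rewrite modulusM modulus_cexp ler_piMr ?modulus_ge0 // -expR0 ler_expR.
have cu (x : R) : x <= 0 -> continuous (u x : R -> R).
  move=> x0 y; have [al [be [ga H]]] := K x y x0.
  have : is_derive y 1 (u x) be.
    apply/is_derive_expansionP => e /H [r r0 hr]; exists r => // t ty.
    have [|+ _] := hr x t _ ty; first by rewrite subrr normr0.
    by rewrite subrr mulr0 subr0 normr0 add0r.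
  by move=> ?; apply/differentiable_continuous/derivable1_diffP; apply: ex_derive.
(* Nothing is known of [g] outside the circle through [z0], while primitives are taken of functions
   continuous on the whole line; [Num.min x 0] freezes [v] beyond the right side x = 0. *)
have cv (y : R) : continuous ((fun x : R => v (Num.min x 0) y) : R -> R).
  move=> x; have [|al [be [ga H]]] := K (Num.min x 0) y; first by rewrite ge_min lexx orbT.
  have dv : is_derive (Num.min x 0) 1 (v ^~ y) ga.
    apply/is_derive_expansionP => e /H [r r0 hr]; exists r => // t ty.
    have [|_ +] := hr t y ty; first by rewrite subrr normr0.
    by rewrite subrr mulr0 subr0 normr0 addr0.
  apply: (@continuous_comp _ _ _ (fun x : R => Num.min x 0) (v ^~ y)).
    by apply: continuous_min; [exact: cvg_id | exact: cvg_cst].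
  by apply/differentiable_continuous/derivable1_diffP; apply: ex_derive.
(* A primitive is a two-sided one only strictly to the right of its base point; the base -1, like a
   - 1 for [Q] below, makes the corner of the rectangle interior. *)
have /choice [P hP] : forall x : R, exists F : R -> R, x <= 0 -> forall y : R, - 1 < y -> is_derive y 1 F (u x y).
  move=> x; have [x0|x0] := leP x 0; last by exists (fun=> 0).
  by have [F hF] := primitive_exists (-1) (cu _ x0); exists F.
have pi0 : 0 <= 2 * pi :> R by rewrite mulr_ge0 // pi_ge0.
(* The horizontal sides at heights 0 and 2 pi carry the same values of [v] by periodicity, so their
   contributions cancel and the mean over the circle of radius |z0| e^a does not depend on a. *)
have Pconst (a : R) : a <= 0 -> P 0 (2 * pi) - P 0 0 = P a (2 * pi) - P a 0.
  move=> a0.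
  have /choice [Q hQ] : forall y : R, exists F : R -> R, forall x : R, a - 1 < x -> is_derive x 1 F (v (Num.min x 0) y).
    by move=> y; apply: primitive_exists (cv y).
  have := @green_goursat R u v P (fun x y => Q y x) a 0 0 (2 * pi) a0 pi0.
  have -> : mixdiff (fun x y => Q y x) a 0 0 (2 * pi) = 0.
    have := @mvt_bound R (Q (2 * pi) - Q 0) (fun=> 0) 0 a 0 a0.
    rewrite mul0r !fctE => h.
    have : `|Q (2 * pi) 0 - Q 0 0 - (Q (2 * pi) a - Q 0 a)| <= 0.
      apply: h => [x /andP[ax x0]|]; last by move=> *; rewrite normr0.
      have ax' : a - 1 < x by lra.
      have ? := hQ (2 * pi) x ax'; have ? := hQ 0 x ax'.
      by apply: is_derive_eq; rewrite /v cexp_2pi subrr.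
    by rewrite normr_le0 /mixdiff => /eqP; lra.
  rewrite /mixdiff => H; have : P 0 (2 * pi) - P 0 0 - P a (2 * pi) + P a 0 = 0; last by lra.
  apply: H => [x y /andP[_ x0] /andP[y0 _]|x y /andP[ax x0] _|x0 y0 /andP[_ /K] /(_ y0)].
  - by apply: hP => //; apply: lt_le_trans y0; rewrite ltrN10.
  - have := hQ y x; rewrite (_ : Num.min x 0 = x) ?min_l //; apply.
    by apply: lt_le_trans ax; rewrite ltrBlDr ltrDl.
  - move=> [al [be [ga H]]] _; exists al, be, ga => e /H [r r0 hr].
    by exists r => // x y _ _; apply: hr.
exists (P 0); first by move=> y /andP[y0 _]; apply: hP => //; apply: lt_le_trans y0; rewrite ltrN10.
apply/eqP; rewrite -subr_eq0 -normr_le0; apply/ler_addgt0Pr => e e0; rewrite add0r.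
have [|r r0 hr] := cg (e / (2 * pi)); first by rewrite divr_gt0 // mulr_gt0 // pi_gt0.
(* The circle for this [a] has radius at most r / 2, where [g] is within e / (2 pi) of its value at
   0. *)
pose a := Num.min 0 (ln (r / (2 * modulus z0))).
have a0 : a <= 0 by rewrite ge_min lexx.
rewrite (Pconst a a0).
have := @mvt_bound R (P a - complex.Re (g 0) *: @idfun R) (fun y => u a y - complex.Re (g 0)) (e / (2 * pi)) 0 (2 * pi) pi0.
rewrite !fctE /GRing.scale /= !subr0 mulr0 subr0 divfK; last by rewrite mulf_neq0 // gt_eqF // pi_gt0.
move=> h; apply: le_trans (h _ _) => {h} [|y /andP[y0 _]|y _].
- by rewrite (mulrC (2 * pi)) addrAC.
- have ? : is_derive y 1 (P a) (u a y) by apply: hP => //; apply: lt_le_trans y0; rewrite ltrN10.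
  rewrite -[X in is_derive _ _ X _]/(P a - complex.Re (g 0) *: @idfun R).
  by apply: is_derive_eq; rewrite /GRing.scale /= mulr1.
- have hz : modulus (z0 * cexp a y) < r.
    rewrite modulusM modulus_cexp.
    have : expR a <= r / (2 * modulus z0).
      rewrite -[leRHS]lnK ?posrE ?divr_gt0 ?mulr_gt0 // ler_expR ge_min lexx orbT //.
    rewrite -(ler_pM2l z0p) => /le_lt_trans; apply.
    have -> : modulus z0 * (r / (2 * modulus z0)) = r / 2 by field; rewrite gt_eqF.
    lra.
  apply: le_trans (hr _ hz); apply: le_trans (Re_le_modulus _).
  by rewrite /u; move: (g _) (g 0) => [? ?] [? ?].
Qed.

End MeanValue.

(** * The Schwarz-Pick lemma *)

Section Mobius.
Variable R : realType.
Local Notation C := R[i].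
Local Notation D := (@disc R).

Lemma holo_comp (U V W : normedModType C) (A : set U) (B : set V) (E : set W)
    (f : U -> V) (g : V -> W) : holo A B f -> holo B E g -> holo A E (g \o f).
Proof.
move=> [df fB] [dg gE]; split => z Az /=; last exact/gE/fB.
by apply: differentiable_comp; [exact: df | exact/dg/fB].
Qed.

(** For |a| < 1, the automorphism of the disc that takes 0 to a; its inverse is [mob (- a)]. *)
Definition mob (a z : C) : C := (z + a) / (1 + conjc a * z).

Lemma mob_den_neq0 (a z : C) : modulus a < 1 -> modulus z < 1 -> 1 + conjc a * z != 0.
Proof.
move=> a1 z1; rewrite -modulus_eq0; apply/negP => /eqP h.
have : modulus (conjc a * z) < 1.
  by rewrite modulusM modulus_conj mulr_ilt1 ?modulus_ge0.
have := modulusB_dist 1 (- (conjc a * z)); rewrite opprK h modulus1 modulusN.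
lra.
Qed.

Lemma sqr_modulus_mob (a z : C) : modulus a < 1 -> modulus z < 1 ->
  1 - modulus (mob a z) ^+ 2 =
    (1 - modulus a ^+ 2) * (1 - modulus z ^+ 2) / modulus (1 + conjc a * z) ^+ 2.
Proof.
move=> a1 z1; have d := mob_den_neq0 a1 z1.
have d' : modulus (1 + conjc a * z) ^+ 2 != 0 by rewrite sqrf_eq0 modulus_eq0.
rewrite /mob modulus_div expr_div_n.
apply/(mulIf d'); rewrite mulfVK // mulrBl mul1r mulfVK //.
apply: complexI; rewrite rmorphB [RHS]rmorphM ![in RHS]rmorphB rmorph1 /= -!mulr_conj.
rewrite !(rmorphD, rmorphM, rmorph1) /= !conjcK; ring.
Qed.

Lemma mob_disc (a z : C) : modulus a < 1 -> modulus z < 1 -> modulus (mob a z) < 1.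
Proof.
move=> a1 z1; have d := mob_den_neq0 a1 z1.
rewrite -(ltr_pXn2r (_ : 0 < 2)%N) ?nnegrE ?modulus_ge0 // expr1n -subr_gt0.
rewrite sqr_modulus_mob // divr_gt0 ?mulr_gt0 ?exprn_gt0 ?modulus_gt0 // subr_gt0.
  by rewrite expr_lt1 ?modulus_ge0.
by rewrite expr_lt1 ?modulus_ge0.
Qed.

Lemma mob0 (a : C) : mob a 0 = a.
Proof. by rewrite /mob mulr0 addr0 add0r divr1. Qed.

Lemma mobN (a : C) : mob (- a) a = 0.
Proof. by rewrite /mob subrr mul0r. Qed.

Lemma mobK (a z : C) : modulus a < 1 -> modulus z < 1 -> mob (- a) (mob a z) = z.
Proof.
move=> a1 z1; have d := mob_den_neq0 a1 z1.
have a1' : modulus (- a) < 1 by rewrite modulusN.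
have d2 := mob_den_neq0 a1' (mob_disc a1 z1).
move: d2; rewrite /mob rmorphN /= => d2.
have d3 : 1 - conjc a * a != 0.
  have := mob_den_neq0 a1' a1; by rewrite rmorphN mulNr.
have e1 : 1 + - conjc a * ((z + a) / (1 + conjc a * z)) = (1 - conjc a * a) / (1 + conjc a * z).
  by field.
by rewrite e1; field; rewrite d3 d.
Qed.

Lemma mobNK (a z : C) : modulus a < 1 -> modulus z < 1 -> mob a (mob (- a) z) = z.
Proof. by move=> a1 z1; rewrite -{1}(opprK a) mobK // modulusN. Qed.

Lemma mob_diff (a z : C) : modulus a < 1 -> modulus z < 1 ->
  differentiable (mob a : C^o -> C^o) (z : C^o).
Proof.
move=> a1 z1; have d := mob_den_neq0 a1 z1.
apply: (@differentiableM C C^o).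
  by apply: differentiableD.
apply: (@differentiableV C C^o (fun z : C^o => 1 + conjc a * z)); last exact: d.
apply: differentiableD; first exact: differentiable_cst.
exact: (@differentiableZ C C^o C^o id (conjc a)).
Qed.

Lemma mob_holo (a : C) : modulus a < 1 -> holo D D (mob a).
Proof.
by move=> a1; split => z /discE z1; [exact: mob_diff | apply/discE; exact: mob_disc].
Qed.

(* The pseudo-hyperbolic distance: atanh (pd a b) is the modulus of the
   discrete datum (a, b). *)
Definition pd (a b : C) : R := modulus ((a - b) / (1 - conjc b * a)).

Lemma pdE (a b : C) : pd a b = modulus (mob (- b) a).
Proof. by rewrite /pd /mob rmorphN mulNr. Qed.

Lemma pd_ge0 (a b : C) : 0 <= pd a b.
Proof. exact: modulus_ge0. Qed.

Lemma pd_lt1 (a b : C) : D a -> D b -> pd a b < 1.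
Proof. by move=> /discE a1 /discE b1; rewrite pdE mob_disc // modulusN. Qed.

Lemma pd0 (a : C) : pd a 0 = modulus a.
Proof. by rewrite /pd conjc0 mul0r !subr0 divr1. Qed.

Lemma pd_eq0 (a b : C) : D a -> D b -> (pd a b == 0) = (a == b).
Proof.
move=> /discE a1 /discE b1; have b1' : modulus (- b) < 1 by rewrite modulusN.
have := mob_den_neq0 b1' a1; rewrite rmorphN mulNr => d.
by rewrite /pd modulus_eq0 mulf_eq0 invr_eq0 (negbTE d) orbF subr_eq0.
Qed.

Lemma pdC (a b : C) : pd a b = pd b a.
Proof.
rewrite /pd !modulus_div modulusBC; congr (_ / _).
by rewrite -modulus_conj rmorphB rmorph1 rmorphM /= conjcK mulrC.
Qed.

Lemma pd_mob (c a b : C) : D c -> D a -> D b -> pd (mob c a) (mob c b) = pd a b.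
Proof.
move=> /discE c1 /discE a1 /discE b1.
have da := mob_den_neq0 c1 a1; have db := mob_den_neq0 c1 b1.
have dc : 1 + conjc (- c) * c != 0 by rewrite mob_den_neq0 // modulusN.
have dab : 1 + conjc (- b) * a != 0 by rewrite mob_den_neq0 // modulusN.
have db' : 1 + c * conjc b != 0.
  by rewrite -conjc_eq0 rmorphD rmorph1 rmorphM /= conjcK.
move: dc dab; rewrite !rmorphN !mulNr => dc dab.
have e1 : mob c a - mob c b = (a - b) * (1 - conjc c * c) / ((1 + conjc c * a) * (1 + conjc c * b)).
  by rewrite /mob; field; rewrite da db.
have e2 : 1 - conjc (mob c b) * mob c a =
    (1 - conjc b * a) * (1 - conjc c * c) / ((1 + conjc c * a) * (1 + c * conjc b)).
  by rewrite /mob rmorphM fmorphV !rmorphD rmorph1 rmorphM /= conjcK; field; rewrite da db'.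
rewrite /pd e1 e2 !(modulusM, modulusV).
have -> : modulus (1 + c * conjc b) = modulus (1 + conjc c * b).
  by rewrite -modulus_conj rmorphD rmorph1 rmorphM /= conjcK.
by field; rewrite !modulus_eq0 da db dc dab.
Qed.

End Mobius.

(** * The Schwarz lemma for the derivative at the centre, with its equality case *)

Section Schwarz.
Variable R : realType.
Local Notation C := R[i].
Local Notation D := (@disc R).
Implicit Types (f g : C^o -> C^o) (z a b c : C).

Lemma diffC f (z : C^o) h : differentiable f z -> 'd f z h = 'D_1 f z * h.
Proof.
move=> df; rewrite deriveE //.
by rewrite -[h in LHS]mulr1 -[h * 1]/(h *: (1 : C^o)) linearZ /= mulrC.
Qed.

Lemma cderiv_differentiable f (z : C^o) : differentiable f z -> cderiv f z ('D_1 f z).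
Proof.
move=> df e e0; have [r r0 hr] := differentiable_nrm df e0.
by exists r => // h hh; have := hr h hh; rewrite diffC.
Qed.

Lemma cderivM (k : C) (g : C -> C) z c : cderiv g z c -> cderiv (fun w => k * g w) z (k * c).
Proof.
move=> H e e0; have k0 : 0 < modulus k + 1 by rewrite ltr_wpDl ?modulus_ge0.
have [|r r0 hr] := H (e / (modulus k + 1)); first by rewrite divr_gt0.
exists r => // h /hr hh.
have -> : k * g (z + h) - k * g z - k * c * h = k * (g (z + h) - g z - c * h) by ring.
rewrite modulusM.
apply: le_trans (ler_wpM2l (modulus_ge0 k) hh) _.
rewrite mulrA ler_wpM2r ?modulus_ge0 //.
rewrite mulrC mulrAC ler_pdivrMr // ler_pM2l //; lra.
Qed.

Lemma mvt_ub (F df : R -> R) (M s t : R) : s <= t ->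
  (forall x : R, s <= x <= t -> is_derive x 1 F (df x)) ->
  (forall x : R, s <= x <= t -> df x <= M) -> F t - F s <= M * (t - s).
Proof.
move=> st hf hM.
have hf' x : x \in `]s, t[ -> is_derive x 1 F (df x).
  by rewrite in_itv /= => /andP[/ltW ax /ltW xb]; apply: hf; rewrite ax.
have cf : {within `[s, t], continuous F}.
  apply: derivable_within_continuous => x; rewrite in_itv /= => /hf h.
  exact: ex_derive.
have [c cab ->] := MVT_segment st hf' cf.
by rewrite ler_wpM2r ?subr_ge0 // hM //; move: cab; rewrite in_itv.
Qed.

(** Equality over the whole interval forces equality over [s, y] for every y, since the bound holds
    on both pieces; thus F is affine with slope M there. *)
Lemma mvt_extremal (F df : R -> R) (M s t : R) : s < t ->
  (forall x : R, s <= x <= t -> is_derive x 1 F (df x)) ->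
  (forall x : R, s <= x <= t -> df x <= M) -> F t - F s = M * (t - s) -> df s = M.
Proof.
move=> st hf hM E.
have lin y : s <= y <= t -> F y - F s = M * (y - s).
  move=> /andP[sy yt].
  have h1 : F y - F s <= M * (y - s).
    apply: mvt_ub => // x /andP[sx xy]; [apply: hf | apply: hM];
    by rewrite sx (le_trans xy).
  have h2 : F t - F y <= M * (t - y).
    apply: mvt_ub => // x /andP[yx xt]; [apply: hf | apply: hM];
    by rewrite xt (le_trans sy).
  lra.
apply/eqP; rewrite -subr_eq0 -normr_le0; apply/ler_addgt0Pr => e e0; rewrite add0r.
have /hf /is_derive_expansionP /(_ _ e0) [r r0 hr] : s <= s <= t by rewrite lexx ltW.
pose y := Num.min t (s + r / 2).
have sy : 0 < y - s by rewrite subr_gt0 lt_min st ltrDl divr_gt0.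
have yr : `|y - s| < r.
  rewrite ger0_norm ?(ltW sy) // ltrBlDl; apply: (@le_lt_trans _ _ (s + r / 2)).
    by rewrite ge_min lexx orbT.
  lra.
have := hr y yr; rewrite lin; last by rewrite -subr_ge0 (ltW sy) ge_min lexx.
by rewrite -mulrBl normrM ler_pM2r ?normr_gt0 ?gt_eqF // distrC.
Qed.

(** The removable singularity of f(z)/z, filled by [c], which will be f'(0). *)
Definition quot0 (f : C -> C) (c : C) (z : C) : C := if z == 0 then c else f z / z.

Lemma quot0_cont f : f 0 = 0 -> differentiable f (0 : C^o) ->
  forall e : R, 0 < e -> exists2 r : R, 0 < r & forall z, modulus z < r ->
     modulus (quot0 f ('D_1 f (0 : C^o)) z - quot0 f ('D_1 f (0 : C^o)) 0) <= e.
Proof.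
move=> f0 /cderiv_differentiable H e e0; have [r r0 hr] := H e e0; exists r => // z /hr.
rewrite add0r f0 subr0 /quot0 eqxx; case: eqVneq => [-> _|z0]; first by rewrite subrr modulus0 ltW.
move=> h; rewrite -(ler_pM2r (_ : 0 < modulus z)) ?modulus_gt0 // -modulusM mulrBl.
by rewrite divfK.
Qed.

Lemma quot0_cderiv f c (z : C^o) : z != 0 -> differentiable f z ->
  exists c', cderiv (quot0 f c) z c'.
Proof.
move=> z0 df.
have dg : differentiable (fun w : C^o => f w * w^-1 : C^o) z.
  apply: (@differentiableM C C^o); first exact: df.
  exact: (@differentiableV C C^o id).
exists ('D_1 (fun w : C^o => f w * w^-1 : C^o) z) => e e0.
have [r r0 hr] := cderiv_differentiable dg e0.
exists (Num.min r (modulus z)); first by rewrite lt_min r0 modulus_gt0.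
move=> h; rewrite lt_min => /andP[/hr + hz].
have zh : z + h != 0.
  rewrite -modulus_gt0; have := modulusB_dist z (- h); rewrite opprK modulusN; lra.
by rewrite /quot0 (negbTE z0) (negbTE zh).
Qed.

(** The factor conj c makes the value at the centre the real number |c|^2, so that the mean value
    property for real parts loses nothing. *)
Lemma quot0_mean f z : holo D D f -> f 0 = 0 -> z != 0 -> D z ->
  let c := 'D_1 f (0 : C^o) in
  exists2 F : R -> R,
    (forall y : R, 0 <= y <= 2 * pi ->
       is_derive y 1 F (complex.Re (conjc c * (f (z * cexp 0 y) / (z * cexp 0 y))))) &
    F (2 * pi) - F 0 = 2 * pi * modulus c ^+ 2.
Proof.
move=> [df fD] f0 z0 /discE z1 c.
have D0 : D 0 by apply/discE; rewrite modulus0.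
have [|e e0|//|F hF hF2] := @mean_value R (fun w => conjc c * quot0 f c w) z.
- move=> w w0 wz; have [|c' h] := @quot0_cderiv f c w w0.
    by apply: df; apply/discE; apply: le_lt_trans z1.
  by exists (conjc c * c'); apply: cderivM.
- have k0 : 0 < modulus c + 1 by rewrite ltr_wpDl ?modulus_ge0.
  have [|r r0 hr] := quot0_cont f0 (df _ D0) (_ : 0 < e / (modulus c + 1)); first by rewrite divr_gt0.
  exists r => // w /hr hw; rewrite -mulrBr modulusM modulus_conj.
  apply: le_trans (ler_wpM2l (modulus_ge0 c) hw) _.
  rewrite mulrC mulrAC ler_pdivrMr // ler_pM2l //; lra.
- exists F; last first.
    by rewrite hF2 /quot0 eqxx [conjc c * c]mulrC mulr_conj.
  move=> y /hF; rewrite /quot0; case: eqP => // /eqP.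
  by rewrite mulf_eq0 (negbTE z0) -modulus_eq0 modulus_cexp gt_eqF // expR_gt0.
Qed.

Lemma schwarz_deriv f : holo D D f -> f 0 = 0 -> modulus ('D_1 f (0 : C^o)) <= 1.
Proof.
move=> hf f0; set c := 'D_1 f _; rewrite leNgt; apply/negP => c1.
(* The midpoint of 1 / |c| and 1. On the circle of radius r the quotient is at most 1 / r, so the
   mean |c|^2 would be at most |c| / r, which is less than |c|^2. *)
pose r := (1 + (modulus c)^-1) / 2.
have c0 : 0 < modulus c by apply: lt_trans c1.
have ci1 : (modulus c)^-1 < 1 by rewrite invf_lt1.
have ci0 : 0 < (modulus c)^-1 by rewrite invr_gt0.
have r0 : 0 < r by rewrite /r; lra.
have r1 : r < 1 by rewrite /r; lra.
have rc : 1 < r * modulus c.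
  by rewrite -ltr_pdivrMr // div1r /r; lra.
have mr : modulus (r%:C%C : C) = r by rewrite modulus_real ger0_norm // ltW.
have rN : (r%:C%C : C) != 0 by rewrite -modulus_gt0 mr.
have rD : D (r%:C%C : C) by apply/discE; rewrite mr.
have [F hF hF2] := quot0_mean hf f0 rN rD.
have pi0 : 0 < 2 * pi :> R by rewrite mulr_gt0 // pi_gt0.
have := mvt_ub (ltW pi0) hF.
move=> /(_ (modulus c / r)); rewrite hF2 subr0.
have -> : (2 * pi * modulus c ^+ 2 <= modulus c / r * (2 * pi)) = false.
  rewrite mulrC ler_pM2r // expr2 ler_pM2l //; apply/negbTE; rewrite -ltNge.
  by rewrite -[r^-1]div1r ltr_pdivrMr // mulrC.
suff h : forall x : R, 0 <= x <= 2 * pi ->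
   complex.Re (conjc c * (f (r%:C%C * cexp 0 x) / (r%:C%C * cexp 0 x))) <= modulus c / r by move/(_ h).
move=> x _; apply: le_trans (ler_norm _) _; apply: le_trans (Re_le_modulus _) _.
have mz : modulus (r%:C%C * cexp 0 x : C) = r by rewrite modulusM modulus_cexp expR0 mulr1.
rewrite modulusM modulus_conj modulus_div mz ler_pM2l // -[leRHS]mul1r ler_pM2r ?invr_gt0 //.
by apply/ltW/discE/hf.2; apply/discE; rewrite mz.
Qed.

(** The real part of conj c f(z)/z is at most 1 on the circle and has mean 1, so it equals 1 at the
    starting point z of the circle; being of modulus at most 1, the number itself is 1. *)
Lemma schwarz_deriv_eq f : holo D D f -> f 0 = 0 -> (forall z, D z -> modulus (f z) <= modulus z) ->
  modulus ('D_1 f (0 : C^o)) = 1 -> forall z, D z -> f z = 'D_1 f (0 : C^o) * z.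
Proof.
move=> hf f0 hle; set c := 'D_1 f _ => c1 z Dz.
have [->|z0] := eqVneq z 0; first by rewrite f0 mulr0.
have [F hF] := quot0_mean hf f0 z0 Dz; rewrite -/c c1 expr1n mulr1 => hF2.
have pi0 : 0 < 2 * pi :> R by rewrite mulr_gt0 // pi_gt0.
have bd w : w != 0 -> D w -> modulus (conjc c * (f w / w)) <= 1.
  move=> w0 Dw; rewrite modulusM modulus_conj c1 mul1r modulus_div ler_pdivrMr ?modulus_gt0 // mul1r.
  exact: hle.
have := mvt_extremal pi0 hF => /(_ 1); rewrite subr0 mul1r => /(_ _ hF2).
rewrite cexp0 mulr1 => h.
have hr : complex.Re (conjc c * (f z / z)) = 1.
  apply: h => x _; apply: le_trans (ler_norm _) _; apply: le_trans (Re_le_modulus _) _.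
  have mz : modulus (z * cexp 0 x) = modulus z by rewrite modulusM modulus_cexp expR0 mulr1.
  by apply: bd; [rewrite -modulus_gt0 mz modulus_gt0 | apply/discE; rewrite mz; apply/discE].
have := bd z z0 Dz; set w := conjc c * _ in hr *.
rewrite -(ler_pXn2r (_ : 0 < 2)%N) ?nnegrE ?modulus_ge0 // sqr_modulus hr expr1n.
rewrite gerDl => im0.
have w1 : w = 1.
  case: w hr im0 => p q /= -> q0; congr Complex; apply/eqP.
  by rewrite -sqrf_eq0 eq_le q0 sqr_ge0.
have := congr1 (fun t => c * t * z) w1.
by rewrite /w mulrA mulr_conj c1 expr1n mul1r divfK // mulr1.
Qed.

End Schwarz.

Section Atanh.
Variable R : realType.
Implicit Types x y : R.

Lemma atanh0 : atanh 0 = 0 :> R.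
Proof. by rewrite /atanh addr0 subr0 divr1 ln1 mul0r. Qed.

Lemma atanh_frac_gt0 x : -1 < x < 1 -> 0 < (1 + x) / (1 - x).
Proof. by move=> h; rewrite divr_gt0 //; lra. Qed.

Lemma atanh_lt x y : -1 < x < 1 -> -1 < y < 1 -> (atanh x < atanh y) = (x < y).
Proof.
move=> hx hy; rewrite /atanh ltr_pM2r ?invr_gt0 // ltr_ln ?posrE ?atanh_frac_gt0 //.
have x0 : 0 < 1 - x by lra.
have y0 : 0 < 1 - y by lra.
rewrite ltr_pdivrMr // mulrAC ltr_pdivlMr //; apply/idP/idP; nra.
Qed.

Lemma atanh_le x y : -1 < x < 1 -> -1 < y < 1 -> (atanh x <= atanh y) = (x <= y).
Proof. by move=> hx hy; rewrite !leNgt atanh_lt. Qed.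

Lemma is_derive_atanh x : -1 < x < 1 -> is_derive x 1 (@atanh R) (1 - x ^+ 2)^-1.
Proof.
move=> hx.
have x0 : 1 - x != 0 by apply/eqP; lra.
have x1 : 1 + x != 0 by apply/eqP; lra.
have d1 : is_derive x 1 (fun y : R => (1 + y) / (1 - y)) (2 / (1 - x) ^+ 2).
  have -> : (fun y : R => (1 + y) / (1 - y)) =
            (cst 1 + @idfun R) * (fun y : R => ((cst 1 - @idfun R) y)^-1) by [].
  have d2 : is_derive x 1 (fun y : R => ((cst 1 - @idfun R) y)^-1) (1 / (1 - x) ^+ 2).
    apply: DeriveDef; first exact: derivableV.
    rewrite deriveV //; have -> : 'D_1 (cst 1 - @idfun R) x = -1.
      by rewrite derive_val sub0r.
    by rewrite /GRing.scale /= mulrN1 opprK div1r.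
  apply: is_derive_eq.
  by rewrite !fctE /GRing.scale /=; field.
have fx : 0 < (1 + x) / (1 - x) by exact: atanh_frac_gt0.
have d3 := @is_derive1_comp R (@ln R) (fun y : R => (1 + y) / (1 - y)) x _ _ (is_derive1_ln fx) d1.
have -> : @atanh R = (2^-1 : R) *: ((@ln R) \o (fun y : R => (1 + y) / (1 - y))).
  by apply/funext => y; rewrite /atanh /= !fctE /GRing.scale /= mulrC.
apply: is_derive_eq.
rewrite /GRing.scale /=; field.
have -> : 1 - x ^+ 2 = (1 - x) * (1 + x) by ring.
by rewrite mulf_neq0 // x0 x1.
Qed.

End Atanh.

(** * The invariant Schwarz-Pick inequality and its equality case *)

Section SchwarzPick.
Variable R : realType.
Local Notation C := R[i].
Local Notation D := (@disc R).
Implicit Types (f g : C^o -> C^o) (z a b c : C).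

Lemma derivC_comp f g (z : C^o) : differentiable f z -> differentiable g (f z) ->
  'D_1 (g \o f) z = 'D_1 g (f z) * 'D_1 f z.
Proof.
move=> df dg; rewrite (deriveE _ (differentiable_comp df dg)).
rewrite (diff_comp df dg) -[LHS]/('d g (f z) ('d f z 1)).
by rewrite (diffC _ dg) -(deriveE (1 : C^o) df).
Qed.

Lemma cderiv_unique (g : C -> C) z c c' : cderiv g z c -> cderiv g z c' -> c = c'.
Proof.
move=> h1 h2; apply/eqP; rewrite -subr_eq0 -modulus_eq0 eq_le modulus_ge0 andbT.
apply/ler_addgt0Pr => e e0; rewrite add0r.
have e20 : 0 < e / 2 by rewrite divr_gt0.
have [r r0 hr] := h1 _ e20; have [s s0 hs] := h2 _ e20.
pose t := Num.min r s / 2.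
have t0 : 0 < t by rewrite divr_gt0 // lt_min r0.
have tm : t < Num.min r s by rewrite /t ltr_pdivrMr // ltr_pMr ?ltr1n // lt_min r0.
move: tm; rewrite lt_min => /andP[tr ts].
have mt : modulus (t%:C%C : C) = t by rewrite modulus_real ger0_norm // ltW.
rewrite -mt in tr ts; have {hr} := hr _ tr; have {hs} := hs _ ts; rewrite mt => k1 k2.
rewrite -(ler_pM2r t0) -{1}mt -modulusM.
have -> : (c - c') * t%:C%C = (g (z + t%:C%C) - g z - c' * t%:C%C) - (g (z + t%:C%C) - g z - c * t%:C%C) by ring.
apply: le_trans (modulusB _ _) _; lra.
Qed.

Lemma deriv_mob0 a : modulus a < 1 ->
  'D_1 (mob a : C^o -> C^o) (0 : C^o) = (1 - modulus a ^+ 2)%:C%C.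
Proof.
move=> a1; have m0 : modulus (0 : C) < 1 by rewrite modulus0.
apply: cderiv_unique (cderiv_differentiable (mob_diff a1 m0)) _ => e e0.
exists (Num.min (1 / 2) (e / 2)); first by rewrite lt_min !divr_gt0.
move=> h; rewrite lt_min => /andP[h2 he].
have h1 : modulus h < 1 by lra.
have d := mob_den_neq0 a1 h1.
have d2 : 1 / 2 <= modulus (1 + conjc a * h).
  have := modulusB_dist 1 (- (conjc a * h)); rewrite opprK modulus1 modulusN.
  have : modulus (conjc a * h) <= modulus h.
    by rewrite modulusM modulus_conj ler_piMl ?modulus_ge0 // ltW.
  lra.
rewrite mob0 add0r rmorphB rmorph1 /= -mulr_conj.
have -> : mob a h - a - (1 - a * conjc a) * h =
   - ((1 - a * conjc a) * conjc a * h / (1 + conjc a * h) * h).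
  by rewrite /mob; field.
rewrite modulusN modulusM ler_wpM2r ?modulus_ge0 //.
rewrite mulr_conj -[X in X - _](rmorph1 (real_complex R)) -rmorphB /= modulus_div.
rewrite ler_pdivrMr ?modulus_gt0 // !modulusM modulus_conj modulus_real.
have q1 : `|1 - modulus a ^+ 2| <= 1.
  rewrite ger0_norm; last by rewrite subr_ge0 expr_le1 ?modulus_ge0 // ltW.
  by rewrite gerBl sqr_ge0.
have q2 : `|1 - modulus a ^+ 2| * modulus a <= 1 by rewrite mulr_ile1 ?modulus_ge0 // ltW.
have q3 : `|1 - modulus a ^+ 2| * modulus a * modulus h <= modulus h.
  by rewrite ler_piMl ?modulus_ge0.
apply: le_trans q3 _; apply: (@le_trans _ _ (e * (1 / 2))); first lra.
by rewrite ler_pM2l.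
Qed.

Lemma deriv_mobN a : modulus a < 1 ->
  'D_1 (mob (- a) : C^o -> C^o) (a : C^o) * (1 - modulus a ^+ 2)%:C%C = 1.
Proof.
move=> a1; rewrite -deriv_mob0 //.
have m0 : modulus (0 : C) < 1 by rewrite modulus0.
have a1' : modulus (- a) < 1 by rewrite modulusN.
have d1 : differentiable (mob a : C^o -> C^o) (0 : C^o) by exact: mob_diff.
have d2 : differentiable (mob (- a) : C^o -> C^o) (mob a 0 : C^o).
  by apply: mob_diff => //; exact: mob_disc.
have := derivC_comp d1 d2; rewrite mob0 => <-.
rewrite -[RHS](@derive_id C C^o (0 : C^o) (1 : C^o)).
apply: near_eq_derive.
apply/nbhs_nrmP; exists 1 => // y; rewrite subr0 => y1 /=.
by rewrite mobK.
Qed.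

(** Conjugating by the automorphisms that take 0 to z and f(z) to 0 reduces this to [schwarz_deriv];
    the chain rule supplies the two factors 1 - | |^2. *)
Lemma schwarz_pick_deriv f z : holo D D f -> D z ->
  modulus ('D_1 f (z : C^o)) * (1 - modulus z ^+ 2) <= 1 - modulus (f z) ^+ 2.
Proof.
move=> hf Dz; have /discE z1 := Dz; have Dfz := hf.2 z Dz; have /discE fz1 := Dfz.
have fz1' : modulus (- f z) < 1 by rewrite modulusN.
have D0 : D 0 by apply/discE; rewrite modulus0.
have h1 := holo_comp (mob_holo z1) hf.
have h2 := holo_comp h1 (mob_holo fz1').
have := schwarz_deriv h2; rewrite /= mob0 mobN => /(_ erefl).
have d1 : differentiable (mob z : C^o -> C^o) (0 : C^o) by apply: (mob_holo z1).1.
have d2 : differentiable f (mob z 0 : C^o) by rewrite mob0; exact: hf.1.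
have d3 : differentiable (mob (- f z) : C^o -> C^o) ((f \o mob z) 0 : C^o).
  by rewrite /= mob0; apply: (mob_holo fz1').1.
have d4 := differentiable_comp d1 d2.
rewrite (derivC_comp d4 d3) (derivC_comp d1 d2) (_ : (f \o mob z) (0 : C^o) = f z) ?mob0; last by rewrite /= mob0.
rewrite deriv_mob0 // !modulusM.
have := congr1 (@modulus R) (deriv_mobN fz1); rewrite modulusM modulus1 !modulus_real.
have p1 : 0 < 1 - modulus z ^+ 2 by rewrite subr_gt0 expr_lt1 ?modulus_ge0.
have p2 : 0 < 1 - modulus (f z) ^+ 2 by rewrite subr_gt0 expr_lt1 ?modulus_ge0.
have aux (m d p q : R) : 0 < p -> 0 < q -> m * `|q| = 1 -> m * (d * `|p|) <= 1 -> d * p <= q.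
  move=> p0 q0; rewrite !gtr0_norm // => mq.
  have -> : m = q^-1 by apply/(mulIf (lt0r_neq0 q0)); rewrite mq mulVf // gt_eqF.
  by rewrite mulrC ler_pdivrMr // mul1r.
exact: aux.
Qed.

(* With |k| = 1 chosen such that k f(b) = |f(b)|, the function
   atanh (Re (k f(tb))) - atanh (t|b|) of t in [0,1] is nonincreasing by the
   infinitesimal inequality; if it vanishes at 1, so does its derivative at 0. *)
Lemma schwarz_ray f b : holo D D f -> f 0 = 0 -> D b ->
  modulus (f b) <= modulus b /\
  (b != 0 -> modulus (f b) = modulus b -> 1 <= modulus ('D_1 f (0 : C^o))).
Proof.
move=> hf f0 Db; have /discE b1 := Db; have /discE fb1 := hf.2 b Db.
have [fb0|fbN] := eqVneq (f b) 0.
  rewrite fb0 modulus0 modulus_ge0; split => // b0 /esym /eqP.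
  by rewrite modulus_eq0 (negbTE b0).
have bN : b != 0 by apply: contraNneq fbN => ->; rewrite f0.
have b0 : 0 < modulus b by rewrite modulus_gt0.
pose k : C := conjc (f b) / (modulus (f b))%:C%C.
have fbp : 0 < modulus (f b) by rewrite modulus_gt0.
have fbC : (modulus (f b))%:C%C != 0 :> C by rewrite -modulus_gt0 modulus_real ger0_norm // ltW.
have k1 : modulus k = 1.
  by rewrite modulus_div modulus_conj modulus_real ger0_norm ?divff ?gt_eqF // ltW.
have kfb : k * f b = (modulus (f b))%:C%C.
  by rewrite /k mulrAC (mulrC _ (f b)) mulr_conj expr2 rmorphM /= mulfK.
clearbody k.
pose phi (t : R) := complex.Re (k * f (t%:C%C * b)).
pose dphi (t : R) := complex.Re (k * 'D_1 f (t%:C%C * b : C^o) * b).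
have mt (t : R) : 0 <= t <= 1 -> modulus (t%:C%C * b) = t * modulus b.
  by move=> /andP[t0 _]; rewrite modulusM modulus_real ger0_norm.
have tb (t : R) : 0 <= t <= 1 -> D (t%:C%C * b).
  move=> ht; apply/discE; rewrite mt //; apply: le_lt_trans b1.
  by rewrite ler_piMl ?modulus_ge0 //; case/andP: ht.
have phi_le (t : R) : `|phi t| <= modulus (f (t%:C%C * b)).
  by apply: le_trans (Re_le_modulus _) _; rewrite modulusM k1 mul1r.
have ReE (k' a1 a2 d' b' : C) (s : R) :
    complex.Re (k' * a1) - complex.Re (k' * a2) - complex.Re (k' * d' * b') * s =
    complex.Re (k' * (a1 - a2 - d' * (s%:C%C * b'))).
  by case: k' a1 a2 d' b' => [k1' k2'] [? ?] [? ?] [? ?] [? ?] /=; ring.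
have dphiE (t : R) : 0 <= t <= 1 -> is_derive t 1 phi (dphi t).
  move=> ht; apply/is_derive_expansionP => e e0.
  have [r r0 hr] := cderiv_differentiable (hf.1 _ (tb t ht)) e0.
  exists r => // y yt.
  have m1 : modulus ((y - t)%:C%C * b) <= `|y - t|.
    by rewrite modulusM modulus_real ler_piMr // ltW.
  have := hr _ (le_lt_trans m1 yt).
  have -> : t%:C%C * b + (y - t)%:C%C * b = y%:C%C * b by rewrite -mulrDl -rmorphD /= addrC subrK.
  move=> h; apply: (@le_trans _ _ (e * modulus ((y - t)%:C%C * b))); last by rewrite ler_pM2l.
  apply: le_trans h; rewrite -[leRHS]mul1r -{1}k1 -modulusM; apply: le_trans (Re_le_modulus _).
  rewrite le_eqVlt; apply/orP; left; apply/eqP; congr (`|_|).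
  exact: ReE.
have dbd (t : R) : 0 <= t <= 1 -> -1 < phi t < 1 /\ -1 < t * modulus b < 1 /\
    dphi t * (1 - phi t ^+ 2)^-1 - modulus b * (1 - (t * modulus b) ^+ 2)^-1 <= 0.
  move=> ht; have Dt := tb t ht; have /discE t1 := Dt; have /discE ft1 := hf.2 _ Dt.
  have sp := schwarz_pick_deriv hf Dt.
  have h1 : -1 < phi t < 1 by rewrite -ltr_norml; apply: le_lt_trans (phi_le t) _.
  rewrite mt // in t1 sp.
  have h2 : -1 < t * modulus b < 1.
    by rewrite t1 andbT; apply: lt_le_trans (mulr_ge0 _ (modulus_ge0 b)); [rewrite ltrN10 | case/andP: ht].
  split => //; split => //.
  have q1 : 0 < 1 - phi t ^+ 2 by rewrite subr_gt0 -real_normK ?num_real // expr_lt1 // ltr_norml.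
  have q2 : 0 < 1 - (t * modulus b) ^+ 2.
    by rewrite subr_gt0 -real_normK ?num_real // expr_lt1 // ltr_norml.
  rewrite subr_le0 ler_pdivrMr // mulrAC ler_pdivlMr //.
  have q3 : dphi t <= modulus ('D_1 f (t%:C%C * b : C^o)) * modulus b.
    apply: le_trans (ler_norm _) _; apply: le_trans (Re_le_modulus _) _.
    by rewrite !modulusM k1 mul1r.
  have q4 : phi t ^+ 2 <= modulus (f (t%:C%C * b)) ^+ 2.
    by rewrite -[phi t ^+ 2]real_normK ?num_real // ler_pXn2r ?nnegrE ?modulus_ge0 // phi_le.
  have q5 : dphi t * (1 - (t * modulus b) ^+ 2) <=
            modulus ('D_1 f (t%:C%C * b : C^o)) * modulus b * (1 - (t * modulus b) ^+ 2).
    by rewrite ler_pM2r.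
  apply: le_trans q5 _; rewrite mulrAC mulrC ler_pM2l //; lra.
pose A := (@atanh R \o phi) - (@atanh R \o (fun t : R => t * modulus b)).
have dA (t : R) : 0 <= t <= 1 ->
    is_derive t 1 A (dphi t * (1 - phi t ^+ 2)^-1 - modulus b * (1 - (t * modulus b) ^+ 2)^-1).
  move=> ht; have [h1 [h2 _]] := dbd t ht; have h3 := dphiE t ht.
  have h4 := is_derive1_comp (is_derive_atanh h1) h3.
  have h5 : is_derive t 1 (fun t : R => t * modulus b) (modulus b).
    have -> : (fun t : R => t * modulus b) = modulus b *: @idfun R.
      by apply/funext => y; rewrite !fctE mulrC.
    by apply: is_derive_eq; rewrite /GRing.scale /= mulr1.
  have h6 := @is_derive1_comp R (@atanh R) (fun t : R => t * modulus b) t _ _ (is_derive_atanh h2) h5.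
  by apply: is_derive_eq; rewrite /GRing.scale /= !(mulrC (_^-1)).
have hA (t : R) : 0 <= t <= 1 -> dphi t * (1 - phi t ^+ 2)^-1 - modulus b * (1 - (t * modulus b) ^+ 2)^-1 <= 0.
  by move=> /dbd [_ [_ ?]].
have A0 : A 0 = 0.
  by rewrite /A !fctE /= /phi !mul0r f0 mulr0 /= atanh0 subrr.
have A1 : A 1 = atanh (modulus (f b)) - atanh (modulus b).
  by rewrite /A !fctE /= /phi !mul1r kfb.
have r1 : -1 < modulus (f b) < 1 by rewrite fb1 andbT; apply: lt_trans fbp; rewrite ltrN10.
have r2 : -1 < modulus b < 1 by rewrite b1 andbT; apply: lt_trans b0; rewrite ltrN10.
split=> [|_ E].
  have := mvt_ub ler01 dA hA; rewrite A0 A1 mul0r subr0 subr_le0 atanh_le //.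
have := mvt_extremal ltr01 dA hA; rewrite A0 A1 E subrr subr0 mul0r => /(_ erefl).
rewrite /phi /dphi !mul0r f0 mulr0 /= expr0n subr0 invr1 !mulr1 => /eqP.
rewrite subr_eq0 => /eqP h.
rewrite -(ler_pM2r b0) mul1r -{1}h; apply: le_trans (ler_norm _) _; apply: le_trans (Re_le_modulus _) _.
by rewrite !modulusM k1 mul1r.
Qed.

Lemma schwarz_rotation f b : holo D D f -> f 0 = 0 -> D b -> b != 0 -> modulus (f b) = modulus b ->
  exists2 u : C, modulus u = 1 & forall z, D z -> f z = u * z.
Proof.
move=> hf f0 Db b0 E; exists ('D_1 f (0 : C^o)).
  by apply/eqP; rewrite eq_le schwarz_deriv // (schwarz_ray hf f0 Db).2.
have c1 : modulus ('D_1 f (0 : C^o)) = 1.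
  by apply/eqP; rewrite eq_le schwarz_deriv // (schwarz_ray hf f0 Db).2.
apply: schwarz_deriv_eq => // z Dz; exact: (schwarz_ray hf f0 Dz).1.
Qed.

Lemma schwarz_pick f a b : holo D D f -> D a -> D b -> pd (f a) (f b) <= pd a b.
Proof.
move=> hf Da Db; have /discE b1 := Db; have Dfb := hf.2 b Db; have /discE fb1 := Dfb.
have fb1' : modulus (- f b) < 1 by rewrite modulusN.
have b1' : modulus (- b) < 1 by rewrite modulusN.
have h := holo_comp (holo_comp (mob_holo b1) hf) (mob_holo fb1').
have Dc : D (mob (- b) a) by apply: (mob_holo b1').2.
have := (schwarz_ray h _ Dc).1; rewrite /= mob0 mobN mobNK -?pdE; [exact|by []|by apply/discE].
Qed.

(** After conjugation sending b and f(b) to 0, equality at one further point makes f a rotation by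
    u; [m] undoes the conjugated rotation with conj u. *)
Lemma schwarz_pick_eq f a b : holo D D f -> D a -> D b -> a <> b -> pd (f a) (f b) = pd a b ->
  exists m : C^o -> C^o, [/\ holo D D m, forall z, D z -> m (f z) = z &
    forall z w, D z -> D w -> pd (f z) (f w) = pd z w].
Proof.
move=> hf Da Db ab E; have /discE a1 := Da.
have /discE b1 := Db; have Dfb := hf.2 b Db; have /discE fb1 := Dfb.
have fb1' : modulus (- f b) < 1 by rewrite modulusN.
have b1' : modulus (- b) < 1 by rewrite modulusN.
have h := holo_comp (holo_comp (mob_holo b1) hf) (mob_holo fb1').
have Dc : D (mob (- b) a) by apply: (mob_holo b1').2.
have [||| u u1 hu] := schwarz_rotation h _ Dc.
- by rewrite /= mob0 mobN.
- by rewrite -modulus_eq0 -pdE pd_eq0 //; apply/eqP.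
- by rewrite /= mobNK // -!pdE.
have fE z : D z -> f z = mob (f b) (u * mob (- b) z).
  move=> Dz; have /discE z1 := Dz.
  have /hu : D (mob (- b) z) by apply: (mob_holo b1').2.
  by rewrite /= mobNK // => <-; rewrite mobNK //; apply/discE/hf.2.
have uu : conjc u * u = 1 by rewrite mulrC mulr_conj u1 expr1n.
have Du z v : modulus v = 1 -> D z -> D (v * z).
  by move=> v1 /discE z1; apply/discE; rewrite modulusM v1 mul1r.
have Dm z : D z -> D (mob (- b) z) by move=> Dz; apply: (mob_holo b1').2.
have hmul : holo D D (fun z : C^o => conjc u * z : C^o).
  split => z Dz; last by apply: Du => //; rewrite modulus_conj.
  exact: (@differentiableZ C C^o C^o id (conjc u)).
exists (mob b \o (fun z : C^o => conjc u * z : C^o) \o mob (- f b)); split.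
- exact: holo_comp (holo_comp (mob_holo fb1') hmul) (mob_holo b1).
- move=> z Dz /=; have /discE z1 := Dz; rewrite (fE z Dz) mobK //; last first.
    by apply/discE/Du/Dm.
  by rewrite mulrA uu mul1r mobNK.
- move=> z w Dz Dw; have Dzu := Du _ _ u1 (Dm z Dz); have Dwu := Du _ _ u1 (Dm w Dw).
  have D' : D (- b) by apply/discE.
  rewrite (fE z Dz) (fE w Dw) pd_mob // -(pd_mob D' Dz Dw).
  rewrite /pd -mulrBr rmorphM /=.
  have -> : 1 - conjc u * conjc (mob (- b) w) * (u * mob (- b) z) = 1 - conjc (mob (- b) w) * mob (- b) z.
    by congr (1 - _); rewrite mulrACA uu mul1r.
  by rewrite -mulrA modulusM u1 mul1r.
Qed.

End SchwarzPick.

(** * From discrete to infinitesimal datums *)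

Section Infinitesimal.
Variable R : realType.
Local Notation C := R[i].
Local Notation D := (@disc R).
Variables (V : normedModType C) (U : set V).
Hypothesis oU : open U.

Lemma differentiable_near_eq (W : normedModType C) (f g : V -> W) (x : V) :
  (\near x, f x = g x) -> differentiable f x -> differentiable g x.
Proof.
move=> fg df; have fgx := nbhs_singleton fg.
have := (@nrm_differentiable R V W g x ('d f x) (diff_continuous df)).
case => // e e0; have [r r0 hr] := differentiable_nrm df e0.
have /nbhs_nrmP [s s0 hs] := fg.
exists (Num.min r s); first by rewrite lt_min r0.
move=> h; rewrite lt_min => /andP[/hr + hhs].
by rewrite -fgx -hs // addrC addKr.
Qed.

Lemma cvg_at0r (g : R -> R) (l : R) :
  (forall e, 0 < e -> exists2 r, 0 < r & forall t, 0 < t < r -> `|g t - l| <= e) ->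
  g t @[t --> 0^'+] --> l.
Proof.
move=> H; apply/cvgrPdist_le => e e0; have [r r0 hr] := H e e0.
near=> t; rewrite distrC; apply: hr; apply/andP; split; first by near: t; exact: nbhs_right_gt.
by near: t; exact: nbhs_right_lt.
Unshelve. all: by end_near. Qed.

Lemma cvg_max_le (f g1 g2 : R -> R) (l l1 l2 : R) :
  f t @[t --> (0 : R)^'+] --> l -> g1 t @[t --> (0 : R)^'+] --> l1 ->
  g2 t @[t --> (0 : R)^'+] --> l2 ->
  (\forall t \near (0 : R)^'+, f t <= Num.max (g1 t) (g2 t)) -> l <= Num.max l1 l2.
Proof.
move=> cf c1 c2 H; rewrite leNgt; apply/negP => lF.
pose m := (Num.max l1 l2 + l) / 2.
have mF : m < l by rewrite /m; lra.
have lm : Num.max l1 l2 < m by rewrite /m; lra.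
have m1 : l1 < m by apply: le_lt_trans lm; rewrite le_max lexx.
have m2 : l2 < m by apply: le_lt_trans lm; rewrite le_max lexx orbT.
near (0 : R)^'+ => t.
have : f t <= Num.max (g1 t) (g2 t) by near: t.
apply/negP; rewrite -ltNge gt_max; apply/andP; split.
  by apply: (@lt_trans _ _ m); near: t; [exact: (cvgr_lt _ c1)|exact: (cvgr_gt _ cf)].
by apply: (@lt_trans _ _ m); near: t; [exact: (cvgr_lt _ c2)|exact: (cvgr_gt _ cf)].
Unshelve. all: by end_near. Qed.

Lemma open_ray (s v : V) : U s -> exists2 r : R, 0 < r & forall t : R, 0 < t < r -> U (s + t%:C%C *: v).
Proof.
move=> Us; have /nbhs_nrmP [r r0 hr] : nbhs s U by exact: open_nbhs_nbhs.
exists (r / (nrm v + 1)); first by rewrite divr_gt0 // ltr_wpDl ?nrm_ge0.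
move=> t /andP[t0 tr]; apply: hr; rewrite addrC addKr nrmZ modulus_real gtr0_norm //.
move: tr; rewrite ltr_pdivlMr ?ltr_wpDl ?nrm_ge0 //; have := nrm_ge0 v; nra.
Qed.

(** In [pd] the numerator divided by t tends to the modulus of the differential on v, and the
    denominator tends to 1 - |F(s)|^2. *)
Lemma pd_ray_cvg (F : V -> C^o) (s v : V) : U s -> holo U D F ->
  pd (F s) (F (s + t%:C%C *: v)) / t @[t --> (0:R)^'+]
    --> datum_modulus (push F (Infinitesimal s v)).
Proof.
move=> Us [dF FD]; have /discE F1 := FD s Us; have df := dF s Us.
rewrite /= deriveE //; set c := 'd F s v.
have M0 : 0 < 1 - modulus (F s) ^+ 2 by rewrite subr_gt0 expr_lt1 ?modulus_ge0.
have E : forall e, 0 < e -> exists2 r : R, 0 < r & forall t : R, 0 < t < r ->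
    modulus (F (s + t%:C%C *: v) - F s - t%:C%C * c) <= e * t.
  move=> e e0; have v0 : 0 < nrm v + 1 by rewrite ltr_wpDl ?nrm_ge0.
  have [|r r0 hr] := @differentiable_nrm R V C^o F s df (e / (nrm v + 1)); first by rewrite divr_gt0.
  exists (r / (nrm v + 1)); first by rewrite divr_gt0.
  move=> t /andP[t0]; rewrite ltr_pdivlMr // => tr.
  have m : nrm (t%:C%C *: v) = t * nrm v by rewrite nrmZ modulus_real gtr0_norm.
  have := hr (t%:C%C *: v); rewrite m linearZ /= => h.
  apply: le_trans (h _) _; first by have := nrm_ge0 v; nra.
  rewrite mulrAC ler_pdivrMr // -mulrA ler_pM2l // ler_pM2l //; lra.
have c1 : modulus (F (s + t%:C%C *: v) - F s) / t @[t --> (0:R)^'+] --> modulus c.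
  apply: cvg_at0r => e e0; have [r r0 hr] := E e e0; exists r => // t ht.
  have /andP[t0 tr] := ht.
  have mt : modulus (t%:C%C : C) = t by rewrite modulus_real gtr0_norm.
  rewrite -(ler_pM2r t0) -[X in _ * X](gtr0_norm t0) -normrM mulrBl divfK ?gt_eqF //.
  have -> : modulus c * t = modulus (t%:C%C * c) by rewrite modulusM mt mulrC.
  apply: le_trans (hr t ht).
  have := modulusB_dist (F (s + t%:C%C *: v) - F s) (t%:C%C * c).
  have := modulusB_dist (t%:C%C * c) (F (s + t%:C%C *: v) - F s).
  by rewrite ler_norml (modulusBC (t%:C%C * c)); lra.
have c2 : modulus (1 - conjc (F (s + t%:C%C *: v)) * F s) @[t --> (0:R)^'+]
            --> 1 - modulus (F s) ^+ 2.
  apply: cvg_at0r => e e0; have [r r0 hr] := E 1 ltr01.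
  have k0 : 0 < modulus c + 1 by rewrite ltr_wpDl ?modulus_ge0.
  exists (Num.min r (e / (modulus c + 1))); first by rewrite lt_min r0 divr_gt0.
  move=> t /andP[t0]; rewrite lt_min => /andP[tr te].
  have ht : 0 < t < r by rewrite t0.
  have mt : modulus (t%:C%C : C) = t by rewrite modulus_real gtr0_norm.
  have b1 : modulus (F (s + t%:C%C *: v) - F s) <= e.
    rewrite -(subrK (t%:C%C * c) (_ - _)); apply: le_trans (modulusD _ _) _.
    rewrite modulusM mt; move: te; rewrite ltr_pdivlMr //.
    have := hr t ht; lra.
  have -> : 1 - modulus (F s) ^+ 2 = modulus (1 - conjc (F s) * F s).
    by rewrite -[LHS](gtr0_norm M0) -modulus_real rmorphB rmorph1 /= -mulr_conj (mulrC (F s)).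
  have b2 : modulus ((1 - conjc (F (s + t%:C%C *: v)) * F s) - (1 - conjc (F s) * F s)) <= e.
    have -> : (1 - conjc (F (s + t%:C%C *: v)) * F s) - (1 - conjc (F s) * F s) =
       - (conjc (F (s + t%:C%C *: v) - F s) * F s) by rewrite rmorphB; ring.
    rewrite modulusN modulusM modulus_conj; apply: le_trans b1.
    by rewrite ler_piMr ?modulus_ge0 // ltW.
  apply: le_trans b2; set x := 1 - _ * _; set y := 1 - _ * _.
  have := modulusB_dist x y; have := modulusB_dist y x.
  by rewrite ler_norml (modulusBC y); lra.
have -> : (fun t : R => pd (F s) (F (s + t%:C%C *: v)) / t) =
   (fun t : R => (modulus (F (s + t%:C%C *: v) - F s) / t) * (modulus (1 - conjc (F (s + t%:C%C *: v)) * F s))^-1).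
  by apply/funext => t; rewrite /pd modulus_div modulusBC mulrAC.
by apply: cvgM => //; apply: cvgV => //; rewrite gt_eqF.
Qed.

Lemma datum_modulus_discrete (a b : C^o) : datum_modulus (Discrete a b) = atanh (pd a b).
Proof. by []. Qed.

Lemma pd_itv (a b : C) : D a -> D b -> -1 < pd a b < 1.
Proof. by move=> Da Db; rewrite pd_lt1 // andbT; apply: lt_le_trans (pd_ge0 a b); rewrite ltrN10. Qed.

(** For a tangent vector v, the discrete inequality between s and s + t v is divided by t, and t
    tends to 0 from the right. *)
Lemma push_modulus_le (F C1 C2 : V -> C^o) :
  holo U D F -> holo U D C1 -> holo U D C2 ->
  (forall s t, U s -> U t -> pd (F s) (F t) <= Num.max (pd (C1 s) (C1 t)) (pd (C2 s) (C2 t))) ->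
  forall d, datum_in U d ->
    datum_modulus (push F d) <= Num.max (datum_modulus (push C1 d)) (datum_modulus (push C2 d)).
Proof.
move=> hF h1 h2 H [s t|s v].
  move=> [Us Ut]; rewrite [push F _]/= !datum_modulus_discrete.
  have i0 := pd_itv (hF.2 s Us) (hF.2 t Ut); have i1 := pd_itv (h1.2 s Us) (h1.2 t Ut).
  have i2 := pd_itv (h2.2 s Us) (h2.2 t Ut).
  by rewrite le_max !atanh_le // -le_max H.
move=> Us; have cF := @pd_ray_cvg _ s v Us hF.
have c1 := @pd_ray_cvg _ s v Us h1; have c2 := @pd_ray_cvg _ s v Us h2.
apply: (cvg_max_le cF c1 c2).
have [r r0 hr] := open_ray v Us.
near=> t.
have t0 : 0 < t by near: t; exact: nbhs_right_gt.
have tr : t < r by near: t; exact: nbhs_right_lt.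
have Ut : U (s + t%:C%C *: v) by apply: hr; rewrite t0.
have := H s _ Us Ut.
by rewrite -(ler_pM2r (_ : 0 < t^-1)) ?invr_gt0 // maxr_pMl ?invr_ge0 ?(ltW t0).
Unshelve. all: by end_near. Qed.

(** Reduces universality, for both types of datum, to an inequality between discrete distances:
    whichever of [C1] and [C2] has the larger modulus at d attains the supremum. With [C1] = [C2] it
    treats a single map. *)
Lemma solves_car_of_pd (C1 C2 : V -> C^o) : holo U D C1 -> holo U D C2 ->
  (forall H : V -> C^o, holo U D H -> forall s t, U s -> U t ->
     pd (H s) (H t) <= Num.max (pd (C1 s) (C1 t)) (pd (C2 s) (C2 t))) ->
  forall d, datum_in U d -> solves_car U d C1 \/ solves_car U d C2.
Proof.
move=> h1 h2 H d Ud.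
have bd (F : V -> C^o) : holo U D F -> (datum_modulus (push F d) <=
   Num.max (datum_modulus (push C1 d)) (datum_modulus (push C2 d)))%R.
  by move=> hF; apply: push_modulus_le => //; exact: H.
have sup (E : V -> C^o) : holo U D E ->
    (forall F, holo U D F -> datum_modulus (push F d) <= datum_modulus (push E d)) ->
    solves_car U d E.
  move=> hE hmax; split => //; apply/eqP; rewrite eq_le; apply/andP; split.
    by apply: ereal_sup_ubound; exists E.
  by apply: ge_ereal_sup => _ [F hF <-]; rewrite lee_fin hmax.
have [le12|le21] := leP (datum_modulus (push C1 d)) (datum_modulus (push C2 d)).
  by right; apply: (sup C2 h2) => F hF; have := bd F hF; rewrite (max_r le12).
by left; apply: (sup C1 h1) => F hF; have := bd F hF; rewrite (max_l (ltW le21)).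
Qed.

End Infinitesimal.

(** * The bidisc *)

Section CardTwo.
Local Open Scope card_scope.

Lemma card_set2P (T : pointedType) (S : set T) :
  S #= `I_2 <-> exists A B, A <> B /\ S = [set A; B].
Proof.
split=> [|[A [B [AB ->]]]].
  move=> /card_esym /card_set_bijP [f [fS finj fsurj]].
  exists (f 0%N), (f 1%N); split.
    by move=> /finj; rewrite !inE /= => /(_ isT isT).
  apply/seteqP; split => [x /fsurj [k /= k2 <-]|x [->|->]]; try exact: fS.
  by case: k k2 => [|[|]] // _; [left | right].
apply/card_esym/card_set_bijP.
exists (fun k => if k == 0%N then A else B); split.
- by move=> [|[|]] //= _; [left | right].
- move=> i j; rewrite !inE /= => i2 j2.
  by case: i j i2 j2 => [|[|//]] [|[|//]] //= _ _ E; case: AB.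
- by move=> x [->|->]; [exists 0%N | exists 1%N].
Qed.

End CardTwo.

Section Bidisc.
Variable R : realType.
Local Notation C := R[i].
Local Notation D := (@disc R).
Local Notation i0 := (ord0 : 'I_2).
Local Notation i1 := (lift ord0 ord0 : 'I_2).

Lemma ord2P (P : 'I_2 -> Prop) : P i0 -> P i1 -> forall i, P i.
Proof.
move=> p0 p1 [[|[|//]] hi].
  by rewrite (_ : Ordinal hi = i0) //; apply: val_inj.
by rewrite (_ : Ordinal hi = i1) //; apply: val_inj.
Qed.

(** Written as a combination of basis rows, so that differentiability and the differential follow
    from the rules for sums and scalar multiples. *)
Definition pair_row (V : normedModType C) (p q : V -> C^o) (z : V) : 'rV[C]_2 :=
  p z *: delta_mx ord0 i0 + q z *: delta_mx ord0 i1.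

Lemma pair_row0 (V : normedModType C) (p q : V -> C^o) z : pair_row p q z ord0 i0 = p z.
Proof. by rewrite /pair_row !mxE !eqxx /= mulr1 mulr0 addr0. Qed.

Lemma pair_row1 (V : normedModType C) (p q : V -> C^o) z : pair_row p q z ord0 i1 = q z.
Proof. by rewrite /pair_row !mxE !eqxx /= mulr1 mulr0 add0r. Qed.

Lemma differentiable_pair_row (V : normedModType C) (p q : V -> C^o) (z : V) :
  differentiable p z -> differentiable q z -> differentiable (pair_row p q) z.
Proof. by move=> dp dq; apply: differentiableD; apply: differentiableZl. Qed.

Lemma holo_pair_row (V : normedModType C) (U : set V) (p q : V -> C^o) :
  holo U D p -> holo U D q -> holo U bidisc (pair_row p q).
Proof.
move=> [dp Dp] [dq Dq]; split => z Uz.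
  by apply: differentiable_pair_row; [exact: dp | exact: dq].
by apply: ord2P; rewrite ?pair_row0 ?pair_row1; [exact: Dp | exact: Dq].
Qed.

(** Once a and a' are moved to 0, multiplication by a constant [l] does it, and the assumption on
    the distances says |l| <= 1. *)
Lemma disc_through (a b a' b' : C) : D a -> D b -> D a' -> D b' -> pd a' b' <= pd a b ->
  exists m : C^o -> C^o, [/\ holo D D m, m a = a' & m b = b'].
Proof.
move=> Da Db Da' Db' h.
have [ab|ab] := eqVneq a b.
  have a'b' : a' = b'.
    apply/eqP; rewrite -pd_eq0 // eq_le pd_ge0 andbT.
    by apply: le_trans h _; rewrite le_eqVlt pd_eq0 // ab eqxx.
  exists (cst a'); split; [|by []|exact: a'b'].
  by split => [z _|z _]; [exact: differentiable_cst | exact: Da'].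
have /discE a1 := Da; have /discE a1' := Da'.
have na : modulus (- a) < 1 by rewrite modulusN.
have na' : modulus (- a') < 1 by rewrite modulusN.
pose w := mob (- a) b.
have w0 : 0 < modulus w by rewrite -pdE lt_def pd_ge0 andbT pd_eq0 // eq_sym.
have wN : w != 0 by rewrite -modulus_gt0.
pose l := mob (- a') b' / w.
have l1 : modulus l <= 1.
  by rewrite modulus_div ler_pdivrMr // mul1r -!pdE pdC (pdC b).
have hm : holo D D (fun z : C^o => l * z : C^o).
  split => z Dz; first exact: (@differentiableZ C C^o C^o id l).
  move/discE: Dz => z1; apply/discE; rewrite modulusM; apply: le_lt_trans z1.
  by rewrite ler_piMl ?modulus_ge0.
exists (mob a' \o (fun z : C^o => l * z : C^o) \o mob (- a)); split.
- exact: holo_comp (holo_comp (mob_holo na) hm) (mob_holo a1').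
- by rewrite /= mobN mulr0 mob0.
- rewrite /= -/w /l divfK // mobNK //; exact/discE.
Qed.

(** The graph is taken over the coordinate in which a and b are farther apart; the other coordinate
    is then a map [m] of it, and K restricted to the graph is a self-map of the disc. *)
Lemma bidisc_pd (K : 'rV[C]_2 -> C^o) (a b : 'rV[C]_2) : holo bidisc D K ->
  bidisc a -> bidisc b ->
  pd (K a) (K b) <= Num.max (pd (a ord0 i0) (b ord0 i0)) (pd (a ord0 i1) (b ord0 i1)).
Proof.
move=> hK Da Db.
have id_holo : holo D D (@idfun C^o) by split => [z _|//]; exact: (@ex_diff _ _ _ _ _ _ _ (is_diff_id z)).
have rowE (x y : 'rV[C]_2) : x ord0 i0 = y ord0 i0 -> x ord0 i1 = y ord0 i1 -> x = y.
  by move=> e0 e1; apply/rowP; apply: ord2P.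
rewrite le_max; apply/orP.
have [le01|/ltW le10] := leP (pd (a ord0 i1) (b ord0 i1)) (pd (a ord0 i0) (b ord0 i0)).
  left; have [m [hm ma mb]] := disc_through (Da i0) (Db i0) (Da i1) (Db i1) le01.
  have hq := holo_comp (holo_pair_row id_holo hm) hK.
  have := schwarz_pick hq (Da i0) (Db i0); rewrite /=.
  rewrite (rowE (pair_row idfun m (a ord0 i0)) a) ?pair_row0 ?pair_row1 //.
  by rewrite (rowE (pair_row idfun m (b ord0 i0)) b) ?pair_row0 ?pair_row1.
right; have [m [hm ma mb]] := disc_through (Da i1) (Db i1) (Da i0) (Db i0) le10.
have hq := holo_comp (holo_pair_row hm id_holo) hK.
have := schwarz_pick hq (Da i1) (Db i1); rewrite /=.
rewrite (rowE (pair_row m idfun (a ord0 i1)) a) ?pair_row0 ?pair_row1 //.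
by rewrite (rowE (pair_row m idfun (b ord0 i1)) b) ?pair_row0 ?pair_row1.
Qed.

Lemma datum_modulus_diag (a : C) : datum_modulus (Discrete (a : C^o) a) = 0.
Proof. by rewrite datum_modulus_discrete /pd subrr mul0r modulus0 atanh0. Qed.

Lemma biholomorphic_bidisc_universal (V : normedModType C) (U : set V) :
  open U -> biholomorphic U (@bidisc R) ->
  exists A B : V -> C^o, A <> B /\ minimal_universal_set U [set A; B].
Proof.
move=> oU [F [G [hF hG FK GK]]].
(* The coordinates of F, set to 0 outside U as membership in [holo_maps] demands. *)
pose E (i : 'I_2) (z : V) : C^o := if `[< U z >] then F z ord0 i else 0.
have EU i z : U z -> E i z = F z ord0 i by move=> Uz; rewrite /E asboolT.
have hE i : holo U D (E i).
  split => z Uz; last by rewrite EU //; exact: hF.2.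
  apply: (@differentiable_near_eq _ _ _ (fun z => F z ord0 i)).
    have : nbhs z U by exact: open_nbhs_nbhs.
    by apply: filterS => w /(EU i) ->.
  apply: (@differentiable_comp _ _ _ _ F (fun M : 'rV[C]_2 => M ord0 i : C^o)).
    exact: hF.1.
  exact: differentiable_coord.
have key d : datum_in U d -> solves_car U d (E i0) \/ solves_car U d (E i1).
  apply: solves_car_of_pd => // H hH s t Us Ut; rewrite !EU //.
  have := bidisc_pd (holo_comp hG hH) (hF.2 s Us) (hF.2 t Ut).
  by rewrite /= !FK.
pose pt (i : 'I_2) (c : C) : 'rV[C]_2 := c *: delta_mx ord0 i.
have ptE i c j : pt i c ord0 j = if j == i then c else 0.
  by rewrite /pt !mxE eqxx /=; case: (j == i); rewrite ?mulr1 ?mulr0.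
have D0 : D 0 by apply/discE; rewrite modulus0.
pose h : C := (2^-1 : R)%:C%C.
have mh : modulus h = 2^-1 by rewrite modulus_real ger0_norm.
have Dh : D h by apply/discE; rewrite mh; lra.
have Dpt i c : D c -> bidisc (pt i c) by move=> Dc j; rewrite ptE; case: ifP.
pose s := G (pt i0 0); pose t i := G (pt i h).
have s0 i : pt i 0 = pt i0 0 by rewrite /pt !scale0r.
have Us : U s by apply: hG.2; exact: Dpt.
have Ut i : U (t i) by apply: hG.2; exact: Dpt.
have Es i : E i s = 0 by rewrite EU // GK ?ptE ?if_same //; exact: Dpt.
have Et i j : E j (t i) = if j == i then h else 0 by rewrite EU // GK ?ptE //; exact: Dpt.
have hN : h != 0 by rewrite -modulus_gt0 mh invr_gt0.
have st i : s <> t i.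
  by move=> /(congr1 (E i)); rewrite Es Et eqxx => /esym/eqP; rewrite (negbTE hN).
have nosolve i j : j != i -> ~ solves_car U (Discrete s (t i)) (E j).
  move=> ji [_ /esym eq]; have : (0 < car U (Discrete s (t i)))%E.
    apply: (@lt_le_trans _ _ (datum_modulus (push (E i) (Discrete s (t i))))%:E); last first.
      by apply: ereal_sup_ubound; exists (E i).
    rewrite lte_fin [push _ _]/= datum_modulus_discrete Es Et eqxx pdC pd0 mh.
    rewrite -[ltLHS]atanh0 atanh_lt; lra.
  by rewrite eq [push _ _]/= Es Et (negbTE ji) datum_modulus_diag ltxx.
exists (E i0), (E i1); split.
  by move=> /(congr1 (fun f => f (t i0))); rewrite !Et /= => /eqP; rewrite (negbTE hN).
split.
  split.
    by move=> _ [->|->]; split => // z Uz; rewrite /E asboolF.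
  move=> d Ud _; case: (key d Ud) => hd; [exists (E i0) | exists (E i1)] => //.
    by left.
  by right.
move=> S' [subS nS] [_ uS'].
have missing i j : (forall k, k = i \/ k = j) -> j != i -> S' `<=` [set E i; E j] -> ~ S' (E i) -> False.
  move=> _ ji sub nE; have [] := uS' (Discrete s (t i)); [by []|exact: st|].
  move=> X SX; have := sub X SX => -[XE|XE]; first by move: SX; rewrite XE.
  by rewrite XE; apply: nosolve.
apply: nS => _ [->|->]; apply: contrapT.
  by apply: (@missing i0 i1) => //; apply: ord2P; [left|right].
apply: (@missing i1 i0) => //; first by apply: ord2P; [right|left].
by rewrite setUC.
Qed.

End Bidisc.

(** * Tautness and properness *)

Section Sequences.
Variable R : realType.
Local Notation C := R[i].
Local Notation D := (@disc R).
Implicit Types V W : normedModType C.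

Definition tendsto V (u : nat -> V) (y : V) :=
  forall e : R, 0 < e -> exists N, forall k, (N <= k)%N -> nrm (u k - y) < e.

Definition increasing (phi : nat -> nat) := {homo phi : j k / (j < k)%N}.

Lemma increasing_ge phi : increasing phi -> forall k, (k <= phi k)%N.
Proof. by move=> h; elim=> // k IH; apply: leq_ltn_trans IH (h _ _ (ltnSn k)). Qed.

Lemma tendsto_unique V (u : nat -> V) x y : tendsto u x -> tendsto u y -> x = y.
Proof.
move=> hx hy; apply/eqP; rewrite -subr_eq0 -nrm_eq0 eq_le nrm_ge0 andbT.
apply/ler_addgt0Pr => e e0; rewrite add0r.
have e20 : 0 < e / 2 by rewrite divr_gt0.
have [N hN] := hx _ e20; have [M hM] := hy _ e20.
have := hN (maxn N M) (leq_maxl _ _); have := hM (maxn N M) (leq_maxr _ _).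
have -> : x - y = (u (maxn N M) - y) - (u (maxn N M) - x).
  by rewrite opprB [RHS]addrC addrA subrK.
have := nrmB (u (maxn N M) - y) (u (maxn N M) - x); lra.
Qed.

Lemma tendsto_sub V (u : nat -> V) x phi : increasing phi -> tendsto u x -> tendsto (u \o phi) x.
Proof.
move=> hp hx e /hx [N hN]; exists N => k Nk; apply: hN.
exact: leq_trans Nk (increasing_ge hp k).
Qed.

Lemma continuous_nrm V W (F : V -> W) x : {for x, continuous F} ->
  forall e : R, 0 < e -> exists2 r : R, 0 < r & forall y, nrm (y - x) < r -> nrm (F y - F x) < e.
Proof.
move=> cF e e0.
have /cF /nbhs_nrmP // : nbhs (F x) [set w | nrm (w - F x) < e].
by apply/nbhs_nrmP; exists e.
Qed.

Lemma tendsto_continuous V W (F : V -> W) (u : nat -> V) x : {for x, continuous F} ->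
  tendsto u x -> tendsto (F \o u) (F x).
Proof.
move=> cF hu e e0; have [r r0 hr] := continuous_nrm cF e0.
by have [N hN] := hu r r0; exists N => k /hN /hr.
Qed.

Lemma tendsto_le V (u : nat -> V) x (c : R) : tendsto u x -> (forall k, nrm (u k) <= c) -> nrm x <= c.
Proof.
move=> hu hc; apply/ler_addgt0Pr => e /hu [N hN].
have := hN N (leqnn N); have := hc N.
have := nrmB_dist x (u N); rewrite nrmBC; lra.
Qed.

Lemma inv_nat_lt (e : R) : 0 < e -> exists N, forall k, (N <= k)%N -> (k.+1%:R)^-1 < e.
Proof.
move=> e0; exists (Num.truncn e^-1) => k Nk.
rewrite -[ltRHS]invrK ltf_pV2 ?posrE ?invr_gt0 //.
by apply: lt_le_trans (truncnS_gt _) _; rewrite ler_nat ltnS.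
Qed.

Lemma uniform_nrm V W (A : set V) (f : nat -> V -> W) (g : V -> W) :
  {uniform A, f @ \oo --> g} -> forall e : R, 0 < e ->
  exists N, forall k, (N <= k)%N -> forall z, A z -> nrm (f k z - g z) < e.
Proof.
move=> H e e0.
have ee : @entourage W [set xy | ball xy.1 (e%:C%C) xy.2].
  by rewrite -entourage_ballE; exists (e%:C%C) => //; rewrite /= ltcR.
have : nbhs (g : {uniform` A -> W}) [set h | forall y, A y -> nrm (h y - g y) < e].
  apply/uniform_nbhs; exists [set xy | ball xy.1 (e%:C%C) xy.2]; split => // h hh y Ay.
  by have := hh y Ay; rewrite /= -ball_normE /ball_ /= distrC ltc_nrm.
by move/H => [N _ hN]; exists N => k Nk; exact: (hN k Nk).
Qed.

(** The values at 0 stay in the compact set {s}, which rules out compact divergence. *)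
Lemma taut_center V (U : set V) (s : V) (f : nat -> C^o -> V) : taut U -> U s ->
  (forall k, holo D U (f k)) -> (forall k, f k 0 = s) ->
  exists phi g, [/\ increasing phi, holo D U g & cvg_locally_uniformly D (f \o phi) g].
Proof.
move=> tU Us hf f0; have [phi hphi [[g hg fg]|dv]] := tU f hf; first by exists phi, g.
have := dv [set 0] [set s] (@compact_set1 _ _) _ (@compact_set1 _ _) _.
case.
- by move=> _ ->; apply/discE; rewrite modulus0.
- by move=> _ ->.
- move=> N _ /(_ N) /= /(_ (leqnn N)) /seteqP[/(_ s) + _] => /=.
  by move=> h; exfalso; apply: h; split => //; exists 0 => //; rewrite /= f0.
Qed.

(** The evaluation points [u k] may move, as the parameters of nearly extremal discs do. *)
Lemma cvg_locally_uniformly_point V (f : nat -> C^o -> V) g (u : nat -> C^o) (z : C^o) :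
  cvg_locally_uniformly D f g -> D z -> {for z, continuous g} ->
  tendsto u z -> (forall k, D (u k)) -> tendsto (fun k => f k (u k)) (g z).
Proof.
move=> fg Dz cg uz uD e e0.
have e20 : 0 < e / 2 by rewrite divr_gt0.
have [A /nbhs_nrmP [r r0 hr] /uniform_nrm /(_ _ e20) [N hN]] := fg z Dz.
have [M hM] := uz r r0.
have [K hK] := tendsto_continuous cg uz e20.
exists (maxn N (maxn M K)) => k; rewrite !geq_max => /and3P[Nk Mk Kk].
have := hN k Nk (u k) (conj (hr _ (hM k Mk)) (uD k)); have := hK k Kk.
have := nrmD (f k (u k) - g (u k)) (g (u k) - g z); rewrite addrA subrK /=; lra.
Qed.

End Sequences.

(** * Discs through two points, properness and extremal discs *)

Section KobPairs.
Variable R : realType.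
Local Notation C := R[i].
Local Notation D := (@disc R).
Variables (V : normedModType C) (U : set V).

(* A disc through s and t can be rescaled so that t has the prescribed
   parameter c; sequences of such discs need no convergence of parameters. *)
Lemma disc_of_kob (s t : V) (c : R) : U s -> U t -> s <> t -> 0 < c < 1 ->
  (kob U (Discrete s t) < (atanh c)%:E)%E ->
  exists f : C^o -> V, [/\ holo D U f, f 0 = s & f c%:C%C = t].
Proof.
move=> Us Ut st /andP[c0 c1] /ereal_inf_lt [_ [z [zD [f hf fz]] <-]].
case: z zD fz => [z1 z2|//] [/discE D1 /discE D2] [f1 f2].
rewrite lte_fin datum_modulus_discrete atanh_lt; last 2 first.
- by apply: pd_itv; apply/discE.
- by rewrite c1 andbT; apply: lt_trans c0; rewrite ltrN10.
move=> hc; pose w := mob (- z1) z2.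
have z1N : modulus (- z1) < 1 by rewrite modulusN.
have wc : modulus w < c by rewrite -pdE pdC.
have cN : (c%:C%C : C) != 0 by rewrite -modulus_gt0 modulus_real gtr0_norm.
pose l := w / c%:C%C.
have l1 : modulus l <= 1.
  by rewrite modulus_div modulus_real gtr0_norm // ler_pdivrMr // mul1r ltW.
have hm : holo D D (fun z : C^o => l * z : C^o).
  split => z Dz; first exact: (@differentiableZ C C^o C^o id l).
  move/discE: Dz => z1'; apply/discE; rewrite modulusM; apply: le_lt_trans z1'.
  by rewrite ler_piMl ?modulus_ge0.
exists (f \o (mob z1 \o (fun z : C^o => l * z : C^o))); split.
- exact: holo_comp (holo_comp hm (mob_holo D1)) hf.
- by rewrite /= mulr0 mob0.
- by rewrite /= /l divfK // /w mobNK.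
Qed.

(* What is used of a universal set {A, B} on a Lempert domain for discrete
   datums; unlike universality it refers to no other map, and it passes
   directly to Moebius translates of A and B. *)
Definition kob_pair (A B : V -> C^o) :=
  [/\ holo U D A, holo U D B & forall s t, U s -> U t -> s <> t ->
     kob U (Discrete s t) = (atanh (pd (A s) (A t)))%:E \/
     kob U (Discrete s t) = (atanh (pd (B s) (B t)))%:E].

Lemma kob_pair_proper A B (s : V) (x : nat -> V) (c : R) : taut U -> kob_pair A B ->
  U s -> (forall k, U (x k)) -> c < 1 ->
  (forall k, pd (A s) (A (x k)) <= c) -> (forall k, pd (B s) (B (x k)) <= c) ->
  exists phi y, [/\ increasing phi, U y & tendsto (x \o phi) y].
Proof.
move=> tU [hA hB hK] Us Ux c1 hcA hcB.
have c0 : 0 <= c by apply: le_trans (hcA 0%N); exact: pd_ge0.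
(* The Kobayashi infimum need not be attained; the strict inequality c < c' yields an actual disc
   for each k, with the same parameter c'. Where x k = s a constant disc is used. *)
pose c' := (1 + c) / 2.
have c'1 : 0 < c' < 1 by rewrite /c'; lra.
have i' : -1 < c' < 1 by rewrite /c'; lra.
have cc' : c < c' by rewrite /c'; lra.
have /choice [f hf] : forall k, exists f : C^o -> V, [/\ holo D U f, f 0 = s & f c'%:C%C = x k].
  move=> k; have [sx|/eqP sx] := eqVneq s (x k).
    by exists (cst s); split => //; split => // z _; exact: differentiable_cst.
  apply: disc_of_kob => //.
  have [->|->] := hK s (x k) Us (Ux k) sx; rewrite lte_fin atanh_lt //.
  - exact: le_lt_trans (hcA k) cc'.
  - by apply: pd_itv; apply: hA.2.
  - exact: le_lt_trans (hcB k) cc'.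
  - by apply: pd_itv; apply: hB.2.
have [||phi [g [hphi hg fg]]] := @taut_center R V U s f tU Us; try by move=> k; have [] := hf k.
have Dc : D (c'%:C%C : C).
  by apply/discE; rewrite modulus_real gtr0_norm; case/andP: c'1.
exists phi, (g (c'%:C%C : C)); split => //; first exact: hg.2.
have := @cvg_locally_uniformly_point R V _ g (fun=> c'%:C%C : C^o) (c'%:C%C : C^o) fg Dc.
move=> h e e0; have [|||N hN] := h _ _ _ e e0.
- exact: differentiable_continuous (hg.1 _ Dc).
- by move=> e' e'0; exists 0%N => k _; rewrite subrr nrm0.
- by [].
exists N => k /hN /=; by have [_ _ ->] := hf (phi k).
Qed.

(** Discs carrying 0 to s and parameters decreasing to p to t have, by tautness, a limit that
    attains the infimum. *)
Lemma kob_extremal (s t : V) (p : R) : taut U -> U s -> U t -> s <> t -> 0 < p < 1 ->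
  kob U (Discrete s t) = (atanh p)%:E ->
  exists f : C^o -> V, [/\ holo D U f, f 0 = s & f p%:C%C = t].
Proof.
move=> tU Us Ut st /andP[p0 p1] hp.
(* The factor (1 - p) / 2 keeps [c k] below 1 already at k = 0. *)
pose c (k : nat) := p + (1 - p) / 2 / k.+1%:R.
have q0 : 0 < (1 - p) / 2 by lra.
have iv (k : nat) : 0 < (k.+1%:R : R)^-1 <= 1 by rewrite invr_gt0 ltr0Sn invf_le1 ?ler1n ?ltr0Sn.
have cp k : p < c k by rewrite ltrDl mulr_gt0 //; case/andP: (iv k).
have c1 k : c k < 1.
  have : (1 - p) / 2 / k.+1%:R <= (1 - p) / 2 by rewrite ler_piMr ?(ltW q0) //; case/andP: (iv k).
  rewrite -(lerD2l p) -/(c k) => /le_lt_trans; apply; lra.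
have /choice [f hf] : forall k, exists f : C^o -> V, [/\ holo D U f, f 0 = s & f (c k)%:C%C = t].
  move=> k; apply: disc_of_kob => //; first by rewrite c1 andbT; apply: lt_trans (cp k).
  have := cp k; have := c1 k; rewrite hp lte_fin => h1 h2; rewrite atanh_lt //; lra.
have [||phi [g [hphi hg fg]]] := @taut_center R V U s f tU Us; try by move=> k; have [] := hf k.
have Dp : D (p%:C%C : C) by apply/discE; rewrite modulus_real gtr0_norm.
exists g; split => //.
- have D0 : D (0 : C) by apply/discE; rewrite modulus0.
  apply: (@tendsto_unique R V (fun=> s)); last by move=> e e0; exists 0%N => k _; rewrite subrr nrm0.
  have h := @cvg_locally_uniformly_point R V _ g (fun=> 0 : C^o) (0 : C^o) fg D0.
  move=> e e0; have [|||N hN] := h _ _ _ e e0.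
  + exact: differentiable_continuous (hg.1 _ D0).
  + by move=> e' e'0; exists 0%N => k _; rewrite subrr nrm0.
  + by [].
  by exists N => k /hN /=; have [_ -> _] := hf (phi k).
- have ct : tendsto (fun k => (c k)%:C%C : C^o) (p%:C%C : C^o).
    move=> e e0; have [N hN] := inv_nat_lt e0; exists N => k /hN h.
    rewrite -rmorphB -[nrm _]/(modulus _) modulus_real /c addrAC subrr add0r.
    rewrite gtr0_norm; last by apply: mulr_gt0 => //; case/andP: (iv k).
    apply: le_lt_trans h; rewrite ler_piMl //; lra.
  apply: (@tendsto_unique R V (fun=> t)); last by move=> e e0; exists 0%N => k _; rewrite subrr nrm0.
  have h := @cvg_locally_uniformly_point R V _ g _ (p%:C%C : C^o) fg Dp _ (tendsto_sub hphi ct).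
  move=> e e0; have [||N hN] := h _ _ e e0.
  + exact: differentiable_continuous (hg.1 _ Dp).
  + move=> k /=; apply/discE; rewrite modulus_real gtr0_norm //.
    by apply: lt_trans p0 _.
  by exists N => k /hN /=; have [_ _ ->] := hf (phi k).
Qed.

End KobPairs.

(** * Zeros of a map as minimisers of its norm *)

Section Descent.
Variable R : realType.
Local Notation C := R[i].
Variables (V W : normedModType C) (U : set V) (F : V -> W).

(** To first order F(x + t h) is (1 - t) F(x), which is shorter than F(x). *)
Lemma descent x h : differentiable F x -> 'd F x h = - F x -> F x != 0 ->
  exists2 r : R, 0 < r & forall t : R, 0 < t < r -> nrm (F (x + t%:C%C *: h)) < nrm (F x).
Proof.
move=> dF dFh Fx; have F0 : 0 < nrm (F x) by rewrite nrm_gt0.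
have h0 : 0 < nrm h + 1 by rewrite ltr_wpDl ?nrm_ge0.
(* With this constant the error is at most t |F(x)| / 2, half of the first-order decrease. *)
have [|r r0 hr] := @differentiable_nrm R V W F x dF (nrm (F x) / (2 * (nrm h + 1))).
  by rewrite divr_gt0 // mulr_gt0.
exists (Num.min 1 (r / (nrm h + 1))); first by rewrite lt_min ltr01 divr_gt0.
move=> t /andP[t0]; rewrite lt_min => /andP[t1]; rewrite ltr_pdivlMr // => tr.
have mt : modulus (t%:C%C : C) = t by rewrite modulus_real gtr0_norm.
have := hr (t%:C%C *: h); rewrite nrmZ mt linearZ /= dFh => hh.
have {}hh := hh (le_lt_trans _ tr).
have : t * nrm h <= t * (nrm h + 1) by rewrite ler_pM2l // lerDl.
move=> /hh {}hh.
have e1 : F (x + t%:C%C *: h) = (F (x + t%:C%C *: h) - F x - t%:C%C *: - F x) + (1 - t)%:C%C *: F x.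
  by rewrite scalerN opprK rmorphB rmorph1 scalerBl scale1r -addrA (addrC (t%:C%C *: _)) !subrK.
rewrite e1; apply: le_lt_trans (nrmD _ _) _.
rewrite nrmZ modulus_real gtr0_norm ?subr_gt0 //.
have : nrm (F x) / (2 * (nrm h + 1)) * (t * nrm h) <= nrm (F x) / 2 * t.
  have -> : nrm (F x) / 2 * t = nrm (F x) / (2 * (nrm h + 1)) * (t * (nrm h + 1)) by field; rewrite gt_eqF.
  by rewrite ler_pM2l ?divr_gt0 ?mulr_gt0 // ler_pM2l // lerDl.
nra.
Qed.

(** The compactness assumption gives a minimiser of the norm, and [descent] excludes a nonzero
    minimum. It is applied to Moebius translates of the pair (A, B) and, in dimension one, to f - x
    on a small disc. *)
Lemma attains_zero x0 : open U -> U x0 -> (forall x, U x -> differentiable F x) ->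
  (forall x, U x -> exists h, 'd F x h = - F x) ->
  (forall x : nat -> V, (forall k, U (x k)) -> (forall k, nrm (F (x k)) <= nrm (F x0)) ->
     exists phi y, [/\ increasing phi, U y & tendsto (x \o phi) y]) ->
  exists2 x, U x & F x = 0.
Proof.
move=> oU Ux0 dF sF cF.
pose E := [set nrm (F x) | x in [set x | U x /\ nrm (F x) <= nrm (F x0)]].
have En : E !=set0 by exists (nrm (F x0)), x0.
have Elb : has_inf E by split => //; exists 0 => _ [x _ <-]; exact: nrm_ge0.
pose m := inf E.
have /choice [x hx] : forall k : nat, exists x, [/\ U x, nrm (F x) <= nrm (F x0) & nrm (F x) < m + (k.+1%:R)^-1].
  move=> k; have [|_ [x [Ux xx0] <-] hxm] := @inf_adherent R E (k.+1%:R)^-1 _ Elb; last by exists x.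
  by rewrite invr_gt0 ltr0Sn.
have [||phi [y [hphi Uy xy]]] := cF x; try by move=> k; have [] := hx k.
have Fy : tendsto (F \o (x \o phi)) (F y).
  by apply: tendsto_continuous xy; apply: differentiable_continuous; exact: dF.
have my : nrm (F y) <= m.
  apply/ler_addgt0Pr => e e0; have e20 : 0 < e / 2 by rewrite divr_gt0.
  have [N hN] := Fy _ e20; have [M hM] := inv_nat_lt e20.
  have := hN (maxn N M) (leq_maxl _ _).
  have := hM _ (leq_trans (leq_maxr N M) (increasing_ge hphi _)).
  have [_ _] := hx (phi (maxn N M)).
  have := nrmB_dist (F y) (F (x (phi (maxn N M)))); rewrite nrmBC /=.
  move: (_^-1) => q; lra.
exists y => //; apply/eqP; apply: contraT => Fy0.
have [h hh] := sF y Uy.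
have [r r0 hr] := descent (dF y Uy) hh Fy0.
have [s s0 hs] := open_ray oU h Uy.
pose t := Num.min r s / 2.
have t0 : 0 < t by rewrite divr_gt0 // lt_min r0.
have : t < Num.min r s by rewrite /t ltr_pdivrMr // ltr_pMr ?ltr1n // lt_min r0.
rewrite lt_min => /andP[tr ts].
have dec := hr t (introT andP (conj t0 tr)).
have Uz := hs t (introT andP (conj t0 ts)).
have : m <= nrm (F (y + t%:C%C *: h)).
  apply: ge_inf; first by case: Elb.
  exists (y + t%:C%C *: h) => //; split => //.
  apply: le_trans (ltW dec) _; apply: tendsto_le Fy _ => k /=.
  by have [] := hx (phi k).
by rewrite leNgt (lt_le_trans dec my).
Qed.

End Descent.

(** * The case n = 2 *)

Section RowNorm.
Variable R : realType.
Local Notation C := R[i].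

Lemma modulus_coord n (v : 'rV[C]_n) i : modulus (v ord0 i) <= nrm v.
Proof.
rewrite -lecR -nrmE modulusE -[`|v|]/(mx_norm v) mx_normE.
exact: (@le_bigmax _ _ _ (0%:nng : {nonneg C}) (fun k => `|v k.1 k.2|%:nng) (ord0, i)).
Qed.

Lemma nrm_attained n (v : 'rV[C]_n.+1) : exists i, nrm v = modulus (v ord0 i).
Proof.
have [->|v0] := eqVneq v 0; first by exists ord0; rewrite nrm0 mxE modulus0.
have /mx_norm_neq0 [[i j] /= h] : mx_norm v != 0 by rewrite -[mx_norm v]/(`|v|) normr_eq0.
by exists j; rewrite /nrm -[`|v|]/(mx_norm v) h (ord1 i).
Qed.

Lemma mulmx_bounded n (N : 'M[C]_(2, n)) : exists2 K : R, 0 < K & forall h : 'rV[C]_2, nrm (h *m N) <= K * nrm h.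
Proof.
exists (nrm (row ord0 N) + nrm (row (lift ord0 ord0) N) + 1).
  by rewrite ltr_wpDl // addr_ge0 ?nrm_ge0.
move=> h; rewrite mulmx_sum_row big_ord_recl big_ord1.
apply: le_trans (nrmD _ _) _; rewrite !nrmZ.
have h0 := modulus_coord h ord0; have h1 := modulus_coord h (lift ord0 ord0).
have := nrm_ge0 (row ord0 N); have := nrm_ge0 (row (lift ord0 ord0) N); have := nrm_ge0 h.
nra.
Qed.

Lemma linear_nrm_continuous (V W : normedModType C) (L : {linear V -> W}) (K : R) :
  0 < K -> (forall h, nrm (L h) <= K * nrm h) -> continuous L.
Proof.
move=> K0 hK x A /nbhs_nrmP [r r0 hr].
apply/nbhs_nrmP; exists (r / K); first by rewrite divr_gt0.
move=> y; rewrite ltr_pdivlMr // mulrC => yx; apply: hr.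
by rewrite -linearB; apply: le_lt_trans (hK _) yx.
Qed.

Lemma inj_linear_dim n m (L : {linear 'rV[C]_n -> 'rV[C]_m}) :
  (forall v, L v = 0 -> v = 0) -> (n <= m)%N.
Proof.
move=> H; have /eqP <- : row_free (lin1_mx L).
  by apply: inj_row_free => v; rewrite mul_rV_lin1; apply: H.
exact: rank_leq_col.
Qed.

Lemma inj_linear_inv n (L : {linear 'rV[C]_n -> 'rV[C]_n}) :
  (forall v, L v = 0 -> v = 0) -> exists N : 'M[C]_n, forall v, L (v *m N) = v /\ L v *m N = v.
Proof.
move=> H; have : row_free (lin1_mx L).
  by apply: inj_row_free => v; rewrite mul_rV_lin1; apply: H.
rewrite row_free_unit => uM; exists (invmx (lin1_mx L)) => v.
by rewrite -!mul_rV_lin1 mulmxKV // mulmxK.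
Qed.

End RowNorm.

Section TwoDim.
Variable R : realType.
Local Notation C := R[i].
Local Notation D := (@disc R).
Local Notation i0 := (ord0 : 'I_2).
Local Notation i1 := (lift ord0 ord0 : 'I_2).

Lemma diff_pair_row (V : normedModType C) (p q : V -> C^o) (z v : V) :
  differentiable p z -> differentiable q z ->
  'd (pair_row p q) z v = pair_row ('d p z) ('d q z) v.
Proof.
move=> dp dq; rewrite /pair_row.
have -> : (fun z => p z *: delta_mx ord0 i0 + q z *: delta_mx ord0 i1 : 'rV[C]_2) =
   (fun z => p z *: (delta_mx ord0 i0 : 'rV[C]_2)) + (fun z => q z *: (delta_mx ord0 i1 : 'rV[C]_2)) by [].
rewrite diffD; last 2 first.
- exact: differentiableZl.
- exact: differentiableZl.
have e0 := congr1 (fun f => f v) (diffZl (delta_mx ord0 i0 : 'rV[C]_2) dp).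
have e1 := congr1 (fun f => f v) (diffZl (delta_mx ord0 i1 : 'rV[C]_2) dq).
exact: (congr2 +%R e0 e1).
Qed.

Lemma pair_row_eq0 (V : normedModType C) (p q : V -> C^o) (z : V) :
  pair_row p q z = 0 -> p z = 0 /\ q z = 0.
Proof.
by move=> h; rewrite -(pair_row0 p q z) -(pair_row1 p q z) h !mxE.
Qed.

Lemma bidisc_nrm (v : 'rV[C]_2) : bidisc v <-> nrm v < 1.
Proof.
split=> [h|h i]; last by apply/discE; apply: le_lt_trans (modulus_coord v i) h.
by have [i ->] := nrm_attained v; apply/discE.
Qed.

(** In the identity [sqr_modulus_mob] for 1 - pd^2 the numerator is at least (1 - m^2)^2 and the
    denominator at most 4, whence [q]. *)
Lemma pd_le_of_modulus (m : R) : 0 <= m < 1 -> exists2 c : R, c < 1 &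
  forall a b : C, modulus a <= m -> modulus b <= m -> pd a b <= c.
Proof.
move=> /andP[m0 m1]; pose q := (1 - m ^+ 2) ^+ 2 / 4.
have m2 : 0 <= m ^+ 2 < 1 by rewrite sqr_ge0 expr_lt1.
have q0 : 0 < q <= 1 by rewrite /q; apply/andP; split; nra.
exists (Num.sqrt (1 - q)).
  by rewrite -[ltRHS]sqrtr1 ltr_sqrt //; lra.
move=> a b am bm; rewrite -(ger0_norm (pd_ge0 a b)) -sqrtr_sqr ler_sqrt ?sqr_ge0 //; last by lra.
have a1 : modulus a < 1 by apply: le_lt_trans am m1.
have b1 : modulus (- b) < 1 by rewrite modulusN; apply: le_lt_trans bm m1.
have := sqr_modulus_mob b1 a1; rewrite -pdE => E.
suff : q <= 1 - pd a b ^+ 2 by lra.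
have d0 : 0 < modulus (1 + conjc (- b) * a) by rewrite modulus_gt0 mob_den_neq0.
have d2 : modulus (1 + conjc (- b) * a) <= 2.
  apply: le_trans (modulusD _ _) _; rewrite modulus1 modulusM modulus_conj.
  have : modulus (- b) * modulus a <= 1 by rewrite mulr_ile1 ?modulus_ge0 // ltW.
  lra.
rewrite E modulusN ler_pdivlMr ?exprn_gt0 //.
have a2 : modulus a ^+ 2 <= m ^+ 2 by rewrite ler_pXn2r ?nnegrE ?modulus_ge0.
have b2 : modulus b ^+ 2 <= m ^+ 2 by rewrite ler_pXn2r ?nnegrE ?modulus_ge0.
have d4 : modulus (1 + conjc (- b) * a) ^+ 2 <= 4.
  have -> : (4 : R) = 2 ^+ 2 by ring.
  by rewrite ler_pXn2r ?nnegrE ?modulus_ge0.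
apply: (@le_trans _ _ (q * 4)); first by rewrite ler_pM2l //; case/andP: q0.
rewrite /q divfK // expr2 ler_pM //; lra.
Qed.

Lemma deriv_mob_neq0 (a w : C) : D a -> D w -> 'D_1 (mob a : C^o -> C^o) (w : C^o) != 0.
Proof.
move=> /discE a1 /discE w1; have a1' : modulus (- a) < 1 by rewrite modulusN.
have d1 : differentiable (mob a : C^o -> C^o) (w : C^o) by exact: mob_diff.
have d2 : differentiable (mob (- a) : C^o -> C^o) (mob a w : C^o).
  by apply: mob_diff => //; exact: mob_disc.
have E : 'D_1 (mob (- a) \o mob a : C^o -> C^o) (w : C^o) = 1.
  rewrite -[RHS](@derive_id C C^o (w : C^o) (1 : C^o)).
  apply: near_eq_derive; apply/nbhs_nrmP; exists (1 - modulus w); first by rewrite subr_gt0.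
  move=> y yw /=; rewrite mobK //.
  by have := modulusB_dist y w; move: yw; rewrite -[nrm _]/(modulus _); lra.
apply/eqP => d0; have := derivC_comp d1 d2; rewrite E d0 mulr0 => /eqP.
by rewrite (negbTE (oner_neq0 C)).
Qed.

Definition immersed_pair (V : normedModType C) (U : set V) (A B : V -> C^o) :=
  forall s v, U s -> 'd A s v = 0 -> 'd B s v = 0 -> v = 0.

Lemma diffC_comp (V : normedModType C) (A : V -> C^o) (g : C^o -> C^o) (s v : V) :
  differentiable A s -> differentiable g (A s) ->
  'd (g \o A) s v = 'D_1 g (A s) * 'd A s v.
Proof.
move=> dA dg; have e0 := congr1 (fun f => f v) (diff_comp dA dg).
exact: etrans e0 (diffC ('d A s v) dg).
Qed.

Lemma mob_comp_diff0 (V : normedModType C) (U : set V) (A : V -> C^o) (a : C) s v :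
  holo U D A -> D a -> U s -> 'd (mob a \o A : V -> C^o) s v = 0 -> 'd A s v = 0.
Proof.
move=> hA Da Us; have dA := hA.1 s Us; have DAs := hA.2 s Us.
have dm : differentiable (mob a : C^o -> C^o) (A s) by move/discE: Da => a1; apply: (mob_holo a1).1.
move=> h; apply/eqP; have := etrans (esym (diffC_comp v dA dm)) h => /eqP.
have aux (x y : C) : x != 0 -> x * y == 0 -> y == 0 by move=> x0; rewrite mulf_eq0 (negbTE x0).
exact: aux (deriv_mob_neq0 Da DAs).
Qed.

Lemma kob_pair_mob (V : normedModType C) (U : set V) (A B : V -> C^o) (a b : C) :
  D a -> D b -> kob_pair U A B -> kob_pair U (mob a \o A) (mob b \o B).
Proof.
move=> Da Db [hA hB hK]; have /discE a1 := Da; have /discE b1 := Db; split.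
- exact: holo_comp hA (mob_holo a1).
- exact: holo_comp hB (mob_holo b1).
- move=> s t Us Ut st; rewrite /= !pd_mob //; try by [apply: hA.2 | apply: hB.2].
  exact: hK.
Qed.

Lemma immersed_pair_mob (V : normedModType C) (U : set V) (A B : V -> C^o) (a b : C) :
  D a -> D b -> kob_pair U A B -> immersed_pair U A B -> immersed_pair U (mob a \o A) (mob b \o B).
Proof.
move=> Da Db [hA hB _] hI s v Us d1 d2; apply: (hI s v Us).
  exact: mob_comp_diff0 hA Da Us d1.
exact: mob_comp_diff0 hB Db Us d2.
Qed.

(** A bound m < 1 on the norm bounds the distances from x 0 in both coordinates, so that x 0 can be
    the common centre of the discs. *)
Lemma pair_row_proper (V : normedModType C) (U : set V) (A B : V -> C^o) (x : nat -> V) (m : R) :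
  taut U -> kob_pair U A B -> (forall k, U (x k)) -> m < 1 ->
  (forall k, nrm (pair_row A B (x k)) <= m) ->
  exists phi y, [/\ increasing phi, U y & tendsto (x \o phi) y].
Proof.
move=> tU hK Ux m1 hm.
have m0 : 0 <= m by apply: le_trans (hm 0%N); exact: nrm_ge0.
have [|c c1 hc] := @pd_le_of_modulus m; first by rewrite m0.
apply: (kob_pair_proper tU hK (Ux 0%N) Ux c1) => k; apply: hc.
- by rewrite -(pair_row0 A B); apply: le_trans (modulus_coord _ _) (hm _).
- by rewrite -(pair_row0 A B); apply: le_trans (modulus_coord _ _) (hm _).
- by rewrite -(pair_row1 A B); apply: le_trans (modulus_coord _ _) (hm _).
- by rewrite -(pair_row1 A B); apply: le_trans (modulus_coord _ _) (hm _).
Qed.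

Lemma immersed_pair_diff (V : normedModType C) (U : set V) (A B : V -> C^o) s v :
  holo U D A -> holo U D B -> immersed_pair U A B -> U s ->
  'd (pair_row A B) s v = 0 -> v = 0.
Proof.
move=> hA hB hI Us; rewrite diff_pair_row; [|exact: hA.1|exact: hB.1].
by move=> /pair_row_eq0 [d1 d2]; exact: hI Us d1 d2.
Qed.

Lemma pair_row_zero (U : set 'rV[C]_2) (A B : 'rV[C]_2 -> C^o) :
  domain U -> taut U -> kob_pair U A B -> immersed_pair U A B ->
  exists2 x, U x & A x = 0 /\ B x = 0.
Proof.
move=> [oU _ [x0 Ux0]] tU hK hI; have [hA hB _] := hK.
have hP := holo_pair_row hA hB.
have h1 (x : ('rV[C]_2 : normedModType C)) : U x -> exists h, 'd (pair_row A B) x h = - pair_row A B x.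
  move=> Ux; have inj v := immersed_pair_diff (v := v) hA hB hI Ux.
  have [N hN] := @inj_linear_inv R 2 ('d (pair_row A B) x) inj.
  by exists (- pair_row A B x *m N); exact: (hN _).1.
have h2 (x : nat -> ('rV[C]_2 : normedModType C)) : (forall k, U (x k)) ->
    (forall k, nrm (pair_row A B (x k)) <= nrm (pair_row A B x0)) ->
    exists phi y, [/\ increasing phi, U y & tendsto (x \o phi) y].
  move=> Ux hx; have /bidisc_nrm m1 := hP.2 x0 Ux0.
  exact: (pair_row_proper tU hK Ux m1 hx).
have [x Ux /pair_row_eq0 h0] := attains_zero oU Ux0 hP.1 h1 h2.
by exists x.
Qed.

Lemma mob_eq0 (a b : C) : D a -> D b -> mob (- b) a = 0 -> a = b.
Proof. by move=> Da Db h; apply/eqP; rewrite -pd_eq0 // pdE h modulus0. Qed.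

(** Composition with the automorphisms that move the coordinates of w to 0 preserves the hypotheses
    and turns w into the origin. *)
Lemma pair_row_onto (U : set 'rV[C]_2) (A B : 'rV[C]_2 -> C^o) (w : 'rV[C]_2) :
  domain U -> taut U -> kob_pair U A B -> immersed_pair U A B ->
  bidisc w -> exists2 x, U x & pair_row A B x = w.
Proof.
move=> dU tU hK hI Dw.
have hN (a : C) : D a -> D (- a) by move=> /discE a1; apply/discE; rewrite modulusN.
have D0 := hN _ (Dw i0); have D1 := hN _ (Dw i1).
have hK' := kob_pair_mob D0 D1 hK; have hI' := immersed_pair_mob D0 D1 hK hI.
have [hA hB _] := hK.
have [x Ux [e0 e1]] := pair_row_zero dU tU hK' hI'.
exists x; first exact: Ux.
apply/rowP; apply: ord2P.
  by rewrite pair_row0; exact: (mob_eq0 (hA.2 x Ux) (Dw i0) e0).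
by rewrite pair_row1; exact: (mob_eq0 (hB.2 x Ux) (Dw i1) e1).
Qed.

Lemma kob_pair_biholomorphic (U : set 'rV[C]_2) (A B : 'rV[C]_2 -> C^o) :
  domain U -> taut U -> kob_pair U A B -> immersed_pair U A B ->
  (forall s t, U s -> U t -> A s = A t -> B s = B t -> s = t) ->
  biholomorphic U (@bidisc R).
Proof.
move=> dU tU hK hI inj; have [hA hB _] := hK.
have hF := holo_pair_row hA hB; set F := pair_row A B in hF.
have Finj s t : U s -> U t -> F s = F t -> s = t.
  move=> Us Ut E; apply: inj => //.
    by rewrite -(pair_row0 A B s) -(pair_row0 A B t) -/F E.
  by rewrite -(pair_row1 A B s) -(pair_row1 A B t) -/F E.
have /choice [G hG] : forall w : ('rV[C]_2 : normedModType C), exists x : ('rV[C]_2 : normedModType C), bidisc w -> U x /\ F x = w.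
  move=> w; have [Dw|nD] := pselect (bidisc w); last by exists 0.
  by have [x Ux Fx] := pair_row_onto dU tU hK hI Dw; exists x.
have GF z : U z -> G (F z) = z.
  by move=> Uz; have [UG FG] := hG _ (hF.2 z Uz); apply: Finj.
(* Continuity of G, by contradiction: the points w + h k tend to w while their images stay at
   distance r from G w. Norms at most m < 1 let properness extract a limit y of the images in U;
   then F y = w, so y = G w. *)
have Gc w : bidisc w -> forall r : R, 0 < r -> exists2 e : R, 0 < e & forall h, nrm h < e ->
    bidisc (w + h) /\ nrm (G (w + h) - G w) < r.
  move=> Dw r r0; apply: contrapT => H.
  have /bidisc_nrm w1 := Dw.
  pose m := (1 + nrm w) / 2.
  have m1 : m < 1 by rewrite /m; lra.
  have d0 : 0 < m - nrm w by rewrite /m; lra.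
  have hm h : nrm h < m - nrm w -> nrm (w + h) <= m.
    by have := nrmD w h; lra.
  have /choice [h hh] : forall k : nat, exists h : 'rV[C]_2,
      [/\ nrm h < m - nrm w, nrm h < (k.+1%:R)^-1 & r <= nrm (G (w + h) - G w)].
    move=> k; apply: contrapT => nh; apply: H.
    exists (Num.min (m - nrm w) (k.+1%:R)^-1); first by rewrite lt_min d0 invr_gt0 ltr0Sn.
    move=> h; rewrite lt_min => /andP[h1 h2]; split.
      by apply/bidisc_nrm; apply: le_lt_trans (hm _ h1) m1.
    by rewrite ltNge; apply/negP => h3; apply: nh; exists h.
  have Dk k : bidisc (w + h k) by have [h1 _ _] := hh k; apply/bidisc_nrm; apply: le_lt_trans (hm _ h1) m1.
  have [|k|phi [y [hphi Uy xy]]] := @pair_row_proper _ U A B (fun k => G (w + h k)) m tU hK _ m1.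
  - by move=> k; have [] := hG _ (Dk k).
  - have [_ FG] := hG _ (Dk k); rewrite -/F FG; apply: hm; by have [] := hh k.
  have Fy : F y = w.
    apply: (@tendsto_unique R _ (F \o ((fun k => G (w + h k)) \o phi))).
      by apply: tendsto_continuous xy; apply: differentiable_continuous; exact: hF.1.
    move=> e e0; have [N hN] := inv_nat_lt e0; exists N => k Nk /=.
    have [_ ->] := hG _ (Dk (phi k)); rewrite addrC addKr.
    have [_ h2 _] := hh (phi k); apply: lt_trans h2 _; apply: hN.
    exact: leq_trans Nk (increasing_ge hphi k).
  have yG : y = G w by rewrite -Fy GF.
  have [N hN] := xy r r0; have [_ _ h3] := hh (phi N).
  by have := hN N (leqnn N); rewrite /= yG ltNge h3.
exists F, G; split => //; last by move=> w Dw; have [] := hG w Dw.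
split=> w Dw; last by have [] := hG w Dw.
have [UG FG] := hG w Dw; have dF := hF.1 _ UG.
have Linj v := immersed_pair_diff (v := v) hA hB hI UG.
have [N hN] := @inj_linear_inv R 2 ('d F (G w)) Linj.
have [K K0 hKb] := mulmx_bounded N.
have [] // := nrm_differentiable (linear_nrm_continuous (L := mulmxr N) K0 hKb) (x := w) (f := G).
move=> e e0.
(* With k the increment of G, the first bound absorbs half of |k| and gives |k| <= 2 K |h|; the
   second makes the resulting error K e' 2 K |h| at most e |h|. *)
pose e' := Num.min (1 / (2 * K)) (e / (2 * K ^+ 2)).
have e'0 : 0 < e' by rewrite lt_min !divr_gt0 ?mulr_gt0 ?exprn_gt0.
have [r r0 hr] := differentiable_nrm dF e'0.
have [d d0 hd] := Gc w Dw r r0.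
exists d => // h /hd [Dh]; set k := G (w + h) - G w => kr.
have := hr k kr.
have -> : G w + k = G (w + h) by rewrite /k addrC subrK.
have [_ ->] := hG _ Dh; rewrite FG (addrC w) addrK => E1.
have E2 : nrm (k - h *m N) <= K * (e' * nrm k).
  have -> : k - h *m N = - ((h - 'd F (G w) k) *m N).
    by rewrite mulmxBl (hN k).2 opprB.
  by rewrite nrmN; apply: le_trans (hKb _) _; rewrite ler_pM2l.
have Ke : K * e' <= 1 / 2.
  have -> : 1 / 2 = K * (1 / (2 * K)) by field; rewrite gt_eqF.
  by rewrite ler_pM2l // ge_min lexx.
have Ke2 : K * e' * (2 * K) <= e.
  have -> : e = K * (e / (2 * K ^+ 2)) * (2 * K) by field; rewrite gt_eqF.
  by rewrite ler_pM2r ?mulr_gt0 // ler_pM2l // ge_min lexx orbT.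
have E3 : nrm k <= 2 * K * nrm h.
  have := nrmD (k - h *m N) (h *m N); rewrite subrK.
  have := hKb h; have : K * (e' * nrm k) <= 1 / 2 * nrm k by rewrite mulrA ler_wpM2r ?nrm_ge0.
  lra.
apply: le_trans E2 _; rewrite mulrA.
apply: (@le_trans _ _ (K * e' * (2 * K * nrm h))).
  by rewrite ler_wpM2l // mulr_ge0 // ltW.
by rewrite mulrA ler_wpM2r ?nrm_ge0.
Qed.

End TwoDim.

(** * The case n = 1 *)

Section OneDim.
Variable R : realType.
Local Notation C := R[i].
Local Notation D := (@disc R).

Lemma connected_clopen_eps (V : normedModType C) (U B : set V) :
  domain U -> B `<=` U -> B !=set0 ->
  (forall x, B x -> exists2 r : R, 0 < r & forall y, nrm (y - x) < r -> U y -> B y) ->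
  (forall x, U x -> ~ B x -> exists2 r : R, 0 < r & forall y, nrm (y - x) < r -> ~ B y) -> B = U.
Proof.
move=> [oU cU _] BU B0 oB cB; apply: cU => //.
  exists B; last by apply/seteqP; split => [x Bx|x []//]; split => //; exact: BU.
  rewrite openE => x Bx; have [r r0 hr] := oB x Bx.
  have /nbhs_nrmP [s s0 hs] : nbhs x U by apply: open_nbhs_nbhs; split => //; exact: BU.
  apply/nbhs_nrmP; exists (Num.min r s); first by rewrite lt_min r0.
  by move=> y; rewrite lt_min => /andP[yr /hs Uy]; exact: hr.
exists (closure B); first exact: closed_closure.
apply/seteqP; split => [x Bx|x [Ux cBx]].
  by split; [exact: BU | exact: subset_closure].
apply: contrapT => nB; have [r r0 hr] := cB x Ux nB.
have [|y [By]] := cBx [set y | nrm (y - x) < r].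
  by apply/nbhs_nrmP; exists r.
by move=> /hr.
Qed.

Lemma differentiable_subc (V W : normedModType C) (f : V -> W) (x : W) (z : V) :
  differentiable f z ->
  differentiable (fun y => f y - x) z /\ 'd (fun y => f y - x) z = 'd f z :> (V -> W).
Proof.
move=> df; apply: (nrm_differentiable (diff_continuous df)) => e e0.
have [r r0 hr] := differentiable_nrm df e0; exists r => // h /hr.
by rewrite opprB addrA subrK.
Qed.

Local Notation V1 := ('rV[C]_1 : normedModType C).

(* Compactness of the discs |z| <= m < 1, deduced from tautness of U. *)
Lemma disc_seq_compact (V : normedModType C) (U : set V) (A B : V -> C^o)
    (f : C^o -> V) (g : V -> C^o) (z : nat -> C^o) (m : R) :
  taut U -> kob_pair U A B -> holo D U f -> holo U D g -> (forall z, D z -> g (f z) = z) ->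
  m < 1 -> (forall k, modulus (z k) <= m) ->
  exists phi y, [/\ increasing phi, D y & tendsto (z \o phi) y].
Proof.
move=> tU hK hf hg gf m1 zm; have [hA hB _] := hK.
have D0 : D (0 : C) by apply/discE; rewrite modulus0.
have Dz k : D (z k) by apply/discE; apply: le_lt_trans (zm k) m1.
have bd (E : V -> C^o) : holo U D E -> forall k, pd (E (f 0)) (E (f (z k))) <= m.
  move=> hE k; have := schwarz_pick (holo_comp hf hE) D0 (Dz k).
  rewrite (pdC 0) pd0 => h; exact: le_trans h (zm k).
have [phi [y [hphi Uy xy]]] := kob_pair_proper tU hK (hf.2 0 D0) (fun k => hf.2 _ (Dz k)) m1 (bd A hA) (bd B hB).
exists phi, (g y); split => //; first exact: hg.2.
move=> e e0; have [N hN] := tendsto_continuous (differentiable_continuous (hg.1 y Uy)) xy e0.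
by exists N => k /hN; rewrite /= gf.
Qed.

(* The fixed point set of f o g, which is f(D), is open: for x near f(z0) the
   minimum of |f - x| on a small disc around z0 is attained inside and is 0. *)
Lemma one_dim_retract (U : set 'rV[C]_1) (A B : 'rV[C]_1 -> C^o)
    (f : C^o -> 'rV[C]_1) (g : 'rV[C]_1 -> C^o) :
  domain U -> taut U -> kob_pair U A B -> holo D U f -> holo U D g ->
  (forall z, D z -> g (f z) = z) -> forall x, U x -> f (g x) = x.
Proof.
move=> dU tU hK hf hg gf.
have D0 : D (0 : C) by apply/discE; rewrite modulus0.
pose E : set V1 := [set x | U x /\ f (g x) = x].
suff <- : E = U by move=> x [].
apply: connected_clopen_eps => //.
- by move=> x [].
- by exists (f 0); split; [exact: hf.2 | rewrite gf].
- move=> x0 [Ux0 fgx0]; pose z0 := g x0; have Dz0 : D z0 by exact: hg.2.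
  have /discE z01 := Dz0.
  have df := hf.1 z0 Dz0.
  pose w : V1 := 'd f z0 (1 : C^o).
  have dfE (z h : C^o) : 'd f z h = h *: 'd f z (1 : C^o).
    by rewrite -linearZ /= [h *: _]mulr1.
  (* The derivative of f cannot vanish, since g o f is the identity near z. *)
  have dN z : D z -> 'd f z (1 : C^o) != 0.
    move=> Dz; apply/eqP => h0; have dfz := hf.1 z Dz; have dgz := hg.1 _ (hf.2 z Dz).
    have e1 : 'd (g \o f) z (1 : C^o) = 0.
      by have := congr1 (fun L => L (1 : C^o)) (diff_comp dfz dgz); rewrite /= h0 linear0.
    have e2 : 'D_1 (g \o f) (z : C^o) = 1.
      rewrite -[RHS](@derive_id C C^o (z : C^o) (1 : C^o)).
      apply: near_eq_derive; apply/nbhs_nrmP; move/discE: (Dz) => z1.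
      exists (1 - modulus z); first by rewrite subr_gt0.
      move=> y yz /=; rewrite gf //; apply/discE.
      by have := modulusB_dist y z; move: yz; rewrite -[nrm _]/(modulus _); lra.
    have e3 := deriveE (1 : C^o) (differentiable_comp dfz dgz).
    have := etrans (esym e2) (etrans e3 e1) => /eqP.
    by rewrite (negbTE (oner_neq0 C)).
  have w0 : 0 < nrm w by rewrite nrm_gt0 dN.
  have [r0 r00 hr0] := differentiable_nrm df (divr_gt0 w0 (ltr0n _ 2)).
  pose r := Num.min (r0 / 2) ((1 - modulus z0) / 2).
  have rp : 0 < r by rewrite lt_min divr_gt0 // divr_gt0 // subr_gt0.
  have rr0 : r < r0.
    by apply: (@le_lt_trans _ _ (r0 / 2)); [rewrite ge_min lexx | lra].
  have rz : modulus z0 + r < 1.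
    have : r <= (1 - modulus z0) / 2 by rewrite ge_min lexx orbT.
    lra.
  (* On the circle |z - z0| = r the first-order expansion gives |f z - f z0| >= c. As x is within c
     / 2 of f z0, a point with |F z| <= |F z0| satisfies |f z - f z0| < c, so limits of minimising
     sequences stay off the circle. *)
  pose c := r * nrm w / 2.
  have c0 : 0 < c by rewrite /c divr_gt0 // mulr_gt0.
  exists (c / 2); first by rewrite divr_gt0.
  move=> x xx0 Ux; split => //.
  pose Dr : set C^o := [set z | modulus (z - z0) < r].
  have DrD z : modulus (z - z0) <= r -> modulus z <= modulus z0 + r.
    by have := modulusB_dist z z0; lra.
  have DrD' z : Dr z -> D z.
    by move=> /ltW /DrD h; apply/discE; apply: le_lt_trans h rz.
  have oDr : open Dr.
    rewrite openE => z hz; apply/nbhs_nrmP; exists (r - modulus (z - z0)); first by rewrite subr_gt0.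
    move=> y; rewrite -[nrm _]/(modulus _) /Dr /=.
    by have := modulusD (y - z) (z - z0); rewrite addrA subrK; lra.
  pose F (z : C^o) : V1 := f z - x.
  have dF z : D z -> differentiable F z /\ 'd F z = 'd f z :> (C^o -> V1).
    by move=> Dz; apply: differentiable_subc; exact: hf.1.
  have Drz0 : Dr z0 by rewrite /Dr /= subrr modulus0.
  have F0 : nrm (F z0) < c / 2 by rewrite /F /z0 fgx0 nrmBC.
  (* Dimension one enters here: the nonzero vector [u] spans the target, so the equation is solved
     by dividing by its coordinate. *)
  have surj z : Dr z -> exists h, 'd F z h = - F z.
    move=> /DrD' Dz; rewrite (dF z Dz).2; have d0 := dN z Dz.
    pose u := 'd f z (1 : C^o); have u0 : u ord0 ord0 != 0.
      by apply: contra d0 => /eqP u0; apply/eqP/rowP => j; rewrite (ord1 j) mxE.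
    exists ((- F z) ord0 ord0 / u ord0 ord0); rewrite dfE.
    by apply/rowP => j; rewrite (ord1 j) mxE divfK.
  have cpt (z : nat -> C^o) : (forall k, Dr (z k)) -> (forall k, nrm (F (z k)) <= nrm (F z0)) ->
      exists phi y, [/\ increasing phi, Dr y & tendsto (z \o phi) y].
    move=> Dz Fz.
    have [phi [y [hphi Dy zy]]] := disc_seq_compact tU hK hf hg gf rz (fun k => DrD _ (ltW (Dz k))).
    exists phi, y; split => //.
    have Fy : nrm (F y) <= nrm (F z0).
      apply: (tendsto_le (tendsto_continuous (differentiable_continuous (dF y Dy).1) zy)) => k /=.
      exact: Fz.
    have yr : modulus (y - z0) <= r.
      have sub_c : {for y, continuous (fun z : C^o => z - z0 : C^o)}.
        apply: differentiable_continuous.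
        exact: (@differentiable_subc C^o C^o id z0 y (@ex_diff _ _ _ _ _ _ _ (is_diff_id y))).1.
      apply: (tendsto_le (tendsto_continuous sub_c zy)) => k; exact/ltW/Dz.
    rewrite /Dr /= lt_neqAle yr andbT; apply/negP => /eqP yE.
    have := hr0 (y - z0); rewrite -[nrm (y - z0)]/(modulus (y - z0)) yE => /(_ rr0).
    rewrite (addrC z0) subrK dfE => h.
    have k1 : nrm ((y - z0) *: 'd f z0 (1 : C^o)) = r * nrm w by rewrite nrmZ yE.
    have k2 := nrmB_dist ((y - z0) *: 'd f z0 (1 : C^o)) (f y - f z0).
    rewrite nrmBC in k2.
    have k3 : nrm (f y - f z0) <= nrm (F y) + nrm (F z0).
      have -> : f y - f z0 = F y - F z0 by rewrite /F opprB addrA subrK.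
      exact: nrmB.
    move: h k1 k2 k3 Fy F0; rewrite /c; lra.
  have [z Drz Fz0] := attains_zero oDr Drz0 (fun z Dz => (dF z (DrD' z Dz)).1) surj cpt.
  have fz : f z = x by apply/eqP; rewrite -subr_eq0; apply/eqP.
  by rewrite -fz gf //; exact: DrD'.
- move=> x Ux nE; have fgN : f (g x) - x != 0.
    by rewrite subr_eq0; apply/eqP => fgx; apply: nE.
  have e0 : 0 < nrm (f (g x) - x) / 2 by rewrite divr_gt0 // nrm_gt0.
  have dfg : differentiable (f \o g) x.
    by apply: differentiable_comp; [exact: hg.1 | exact/hf.1/hg.2].
  have [r r0 hr] := continuous_nrm (differentiable_continuous dfg) e0.
  exists (Num.min r (nrm (f (g x) - x) / 2)); first by rewrite lt_min r0.
  move=> y; rewrite lt_min => /andP[/hr h1 h2] [_ fgy].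
  move: h1; rewrite /= fgy.
  have := nrmD (f (g x) - y) (y - x); rewrite addrA subrK (nrmBC _ y); lra.
Qed.

End OneDim.

(** * Universal pairs *)

Section Universal.
Variable R : realType.
Local Notation C := R[i].
Local Notation D := (@disc R).
Variables (V : normedModType C) (U : set V).
Hypothesis hU : lempert_domain U.

Lemma car_pd_le (A : V -> C^o) (s t : V) : U s -> U t -> solves_car U (Discrete s t) A ->
  forall H : V -> C^o, holo U D H -> pd (H s) (H t) <= pd (A s) (A t).
Proof.
move=> Us Ut [hA eA] H hH.
have : ((datum_modulus (push H (Discrete s t)))%:E <= car U (Discrete s t))%E.
  by apply: ereal_sup_ubound; exists H.
rewrite -eA lee_fin [push H _]/= [push A _]/= !datum_modulus_discrete atanh_le //.
  by apply: pd_itv; apply: hH.2.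
by apply: pd_itv; apply: hA.2.
Qed.

Lemma universal_set1 (A : V -> C^o) : holo_maps U A ->
  (forall H : V -> C^o, holo U D H -> forall s t, U s -> U t -> pd (H s) (H t) <= pd (A s) (A t)) ->
  universal_set U [set A].
Proof.
move=> hA hmax; split => [_ ->//|d Ud _]; exists A => //.
have [[oU _ _] _ _ _] := hU.
have [||] // := @solves_car_of_pd R V U oU A A hA.1 hA.1 _ d Ud.
by move=> H hH s t Us Ut; rewrite maxxx; exact: hmax.
Qed.

(** A map solving all discrete datums solves the infinitesimal ones too, so a failure anywhere shows
    up at a discrete datum, the kind through which an extremal disc is available. *)
Lemma not_universal_discrete (A : V -> C^o) : holo_maps U A -> ~ universal_set U [set A] ->
  exists s t, [/\ U s, U t, s <> t & ~ solves_car U (Discrete s t) A].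
Proof.
move=> hA nU; apply: contrapT => h; apply: nU; apply: universal_set1 => // H hH s t Us Ut.
have [<-|/eqP st] := eqVneq s t.
  by rewrite {1}/pd subrr mul0r modulus0 pd_ge0.
apply: car_pd_le => //; apply: contrapT => nS; apply: h.
by exists s, t.
Qed.

Variables A B : V -> C^o.
Hypothesis uAB : universal_set U [set A; B].

Lemma universal_holo : holo_maps U A /\ holo_maps U B.
Proof. by have [sub _] := uAB; split; apply: sub; [left|right]. Qed.

Lemma universal_solves d : datum_in U d -> nondegenerate d -> solves_car U d A \/ solves_car U d B.
Proof. by have [_ h] := uAB => Ud nd; have [_ [->|->]] := h d Ud nd; [left|right]. Qed.

(** Positivity is weak hyperbolicity; it is what makes the pair (A, B) separate points. *)
Lemma solves_kob (E : V -> C^o) s t : U s -> U t -> s <> t -> solves_car U (Discrete s t) E ->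
  kob U (Discrete s t) = (atanh (pd (E s) (E t)))%:E /\ 0 < pd (E s) (E t).
Proof.
move=> Us Ut st [hE eE]; have [_ wh _ ck] := hU.
have Ud : datum_in U (Discrete s t) by [].
split; first by rewrite -(ck _ Ud st) -eE.
have := wh _ Ud st; rewrite -eE lte_fin [push E _]/= datum_modulus_discrete -[X in X < _]atanh0.
rewrite atanh_lt //; first by rewrite ltrN10 ltr01.
by apply: pd_itv; apply: hE.2.
Qed.

Lemma universal_kob_pair : kob_pair U A B.
Proof.
have [[hA _] [hB _]] := universal_holo; split => // s t Us Ut st.
have Ud : datum_in U (Discrete s t) by [].
by have [h|h] := universal_solves Ud st; [left|right]; have [] := solves_kob Us Ut st h.
Qed.

Lemma universal_inj s t : U s -> U t -> A s = A t -> B s = B t -> s = t.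
Proof.
move=> Us Ut eA eB; apply: contrapT => st.
have Ud : datum_in U (Discrete s t) by [].
have [h|h] := universal_solves Ud st; have [_] := solves_kob Us Ut st h.
  by rewrite eA /pd subrr mul0r modulus0 ltxx.
by rewrite eB /pd subrr mul0r modulus0 ltxx.
Qed.

Lemma universal_immersed : immersed_pair U A B.
Proof.
have [[hA _] [hB _]] := universal_holo; have [_ wh _ _] := hU.
move=> s v Us dA dB; apply: contrapT => v0.
have Ud : datum_in U (Infinitesimal s v) by [].
have zero (E : V -> C^o) : holo U D E -> 'd E s v = 0 -> ~ solves_car U (Infinitesimal s v) E.
  move=> hE dE [_ eE]; have := wh _ Ud v0; rewrite -eE lte_fin /= deriveE; last exact: hE.1.
  by rewrite dE modulus0 mul0r ltxx.
by have [h|h] := universal_solves Ud v0; [exact: zero hA dA h | exact: zero hB dB h].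
Qed.

End Universal.

Section OneDimUniversal.
Variable R : realType.
Local Notation C := R[i].
Local Notation D := (@disc R).

Lemma one_dim_universal (U : set 'rV[C]_1) (A B : 'rV[C]_1 -> C^o) (s t : 'rV[C]_1) :
  lempert_domain U -> universal_set U [set A; B] -> U s -> U t -> s <> t ->
  solves_car U (Discrete s t) A -> universal_set U [set A].
Proof.
move=> hU uAB Us Ut st sA; have hK := universal_kob_pair hU uAB.
have [[hA zA] _] := universal_holo uAB.
have [dU _ tU _] := hU.
have [hkob p0] := solves_kob hU Us Ut st sA.
have p1 : pd (A s) (A t) < 1 by apply: pd_lt1; exact: hA.2.
have p01 : 0 < pd (A s) (A t) < 1 by rewrite p0.
have [f [hf f0 fp]] := kob_extremal tU Us Ut st p01 hkob.
set p : C := (pd (A s) (A t))%:C%C in fp.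
have D0 : D (0 : C) by apply/discE; rewrite modulus0.
have mp : modulus p = pd (A s) (A t) by rewrite modulus_real gtr0_norm.
have Dp : D p by apply/discE; rewrite mp.
have pN : p <> 0 by apply/eqP; rewrite -modulus_gt0 mp.
have [|m [hm mK _]] := schwarz_pick_eq (holo_comp hf hA) Dp D0 pN.
  by rewrite /= f0 fp pd0 mp pdC.
have hg := holo_comp hA hm.
(* Since f o m o A is the identity on U, every H equals (H o f) o m o A there; the two self-maps H o
   f and m of the disc decrease distances, so H is dominated by A. *)
have fg := one_dim_retract dU tU hK hf hg mK.
apply: universal_set1 => // H hH x y Ux Uy.
have := schwarz_pick (holo_comp hf hH) (hg.2 x Ux) (hg.2 y Uy).
rewrite /= [f (m (A x))](fg x Ux) [f (m (A y))](fg y Uy) => h; apply: le_trans h _.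
by apply: schwarz_pick => //; exact: hA.2.
Qed.

End OneDimUniversal.

Local Open Scope card_scope.

Theorem theorem2p3 (R : realType) (n : nat) (hn : (1 <= n)%N)
    (Omega : set 'rV[R[i]]_n) (hOmega : lempert_domain Omega) :
  biholomorphic Omega (@bidisc R) <->
  exists2 S, minimal_universal_set Omega S & S #= `I_2.
Proof.
split.
  have [[oU _ _] _ _ _] := hOmega.
  move=> /(biholomorphic_bidisc_universal oU) [A [B [AB mAB]]].
  by exists [set A; B] => //; apply/card_set2P; exists A, B.
move=> [S mS /card_set2P [A [B [AB SE]]]]; move: mS; rewrite {S}SE => -[uAB mAB].
have [dU _ tU _] := hOmega; have [oU _ [x0 Ux0]] := dU.
have hK := universal_kob_pair hOmega uAB; have hI := universal_immersed hOmega uAB.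
have [hA hB _] := hK.
(* The differential of (A, B) at one point is an injective linear map into C^2. *)
have n2 : (n <= 2)%N.
  by apply: (@inj_linear_dim R n 2 ('d (pair_row A B) x0)) => v; exact: immersed_pair_diff hA hB hI Ux0.
case: n hn Omega hOmega A B AB uAB mAB dU tU oU x0 Ux0 hK hI hA hB n2 => [//|[|[|//]]] _ Omega hOmega A B AB uAB mAB dU tU oU x0 Ux0 hK hI hA hB _.
- exfalso.
  have [hmA hmB] := universal_holo uAB.
  (* Since A and B are distinct, {B} is a proper subset, and minimality applies; a discrete datum
     that B misses must be solved by A. *)
  have nB : ~ universal_set Omega [set B].
    apply: mAB; split; first by move=> _ ->; right.
    by move=> /(_ A (or_introl erefl)).
  have [s [t [Us Ut st nS]]] := not_universal_discrete hOmega hmB nB.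
  have Ud : datum_in Omega (Discrete s t) by [].
  have [sA|//] := universal_solves uAB Ud st.
  apply: (mAB [set A]); last exact: one_dim_universal hOmega uAB Us Ut st sA.
  split; first by move=> _ ->; left.
  by move=> /(_ B (or_intror erefl)) BA; apply: AB.
- exact: kob_pair_biholomorphic dU tU hK hI (universal_inj hOmega uAB).
Qed.
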